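(* Suppose that $c^2W_E^2+WW_{EE}\neq0$. Whitham's system of modulation equations $$\begin{pmatrix}E\\c\end{pmatrix}_t+\mathbf{U}(E,c)\begin{pmatrix}E\\c\end{pmatrix}_x=0$$ is hyperbolic (resp., elliptic) if and only if $\rho=1$ (resp., $\rho=-1$), where $\rho$ is the modulational instability index.
   Context: Potential. $V:\mathbb{R}\to\mathbb{R}$ is of class $C^2$, periodic with fundamental period $2\pi$, has exactly two critical points per period, both non-degenerate, and $\min V=-1$, $\max V=1$. Fix a minimizer $\underline u$ and a maximizer $\overline u$ of $V$. Waves. A traveling wave $u=f(z)$, $z=x-ct$, $c\neq\pm1$, of the nonlinear Klein-Gordon equation $u_{tt}-u_{xx}+V'(u)=0$ satisfies $(c^2-1)f_{zz}+V'(f)=0$ and $\tfrac12(c^2-1)f_z^2=E-V(f)$. A periodic traveling wave is one with $f_z$ non-constant and periodic; $T>0$ is the smallest number with $f(z+T)=f(z)$ for all $z$ (librational) or $f(z+T)=f(z)\pm2\pi$ for all $z$ (rotational). $\mathbb{G}$ is the set of $(E,c)$ with: $c^2<1,|E|<1$ (subluminal librational); $c^2<1,E<-1$ (subluminal rotational); $c^2>1,|E|<1$ (superluminal librational); or $c^2>1,E>1$ (superluminal rotational). For $(E,c)\in\mathbb{G}$, $f(z;E,c)$ is normalized by $f_z(0)>0$ and $f(0)=\overline u$ (if $c^2<1$) or $f(0)=\underline u$ (if $c^2>1$), and $T=T(E,c)$. Everything is evaluated at a given $(E,c)\in\mathbb{G}$. Modulational instability index. $\mathbf{F}(z,\lambda)$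 is the $2\times2$ fundamental matrix, $\mathbf{F}(0,\lambda)=\mathbb{I}$, of $\mathbf{w}_z=\mathbf{A}(z,\lambda)\mathbf{w}$ with $$\mathbf{A}(z,\lambda)=\begin{pmatrix}0&1\\-\frac{\lambda^2+V''(f(z))}{c^2-1}&\frac{2c\lambda}{c^2-1}\end{pmatrix},$$ $\mathbf{M}(\lambda)=\mathbf{F}(T,\lambda)$, and the index of the wave $f(\cdot;E,c)$ is $\rho=\mathrm{sgn}(M_{12}(0))$ ($\rho=0$ if $M_{12}(0)=0$). Whitham's system. Let $$W(E,c)=(c^2-1)\int_0^Tf_z(z;E,c)^2\,dz,$$ with subscripts denoting partial derivatives. Averaging over a period the densities and fluxes of the two local conservation laws $(\tfrac12u_t^2+\tfrac12u_x^2+V(u))_t+(-u_tu_x)_x=0$ and $(-u_tu_x)_t+(\tfrac12u_t^2+\tfrac12u_x^2-V(u))_x=0$, and allowing $(E,c)$ to depend on $(x,t)$, leads to the quasilinear system above with coefficient matrix $$\mathbf{U}(E,c)=\frac{1}{c^2W_E^2+WW_{EE}}\begin{pmatrix}(W_E^2+WW_{EE})c&-WW_E\\(c^2-1)^2W_EW_{EE}&(W_E^2+WW_{EE})c\end{pmatrix}.$$ The eigenvalues of the real matrix $\mathbf{U}(E,c)$ are either real or form a complex-conjugate pair; the system is said to be hyperbolic at $(E,c)$ in the real case and elliptic at $(E,c)$ in the complex-conjugate case.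
   Formalization: ''Hyperbolic'' is taken to mean real eigenvalues together with a full set of eigenvectors, not merely real eigenvalues; with the latter the claim fails at ρ=0 (W_EE=0), where U is a Jordan block with a double real eigenvalue. *)

(* Defs.v *)
From HB Require Import structures.
From mathcomp Require Import all_boot all_order all_algebra.
From mathcomp Require Import complex.
From mathcomp Require Import all_classical all_reals all_analysis.

Set Implicit Arguments.
Unset Strict Implicit.
Unset Printing Implicit Defensive.

Import Order.TTheory GRing.Theory Num.Theory.
Import numFieldNormedType.Exports.

Local Open Scope ring_scope.
Local Open Scope classical_set_scope.
Local Open Scope card_scope.

Section Potential.
Context {R : realType}.
Implicit Types (V g : R -> R) (umin umax : R).

Definition class_C2 g : Prop :=
  [/\ forall x, derivable g x 1,
      forall x, derivable (derive1 g) x 1 &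
      continuous (derive1n 2 g)].

Definition fundamental_period g (p : R) : Prop :=
  [/\ 0 < p, periodic g p & forall q, 0 < q -> periodic g q -> p <= q].

(* [umin] and [umax] are the chosen minimizer and maximizer of [V]. *)
Definition potential V umin umax : Prop :=
  [/\ class_C2 V,
      fundamental_period V (2 * pi),
      [set u | 0 <= u < 2 * pi /\ derive1 V u = 0] #= `I_2,
      forall u, derive1 V u = 0 -> derive1n 2 V u != 0 &
      [/\ V umin = -1, V umax = 1 & forall u, -1 <= V u <= 1]].

End Potential.

Section Waves.
Context {R : realType}.
Implicit Types (V g : R -> R) (E c T umin umax : R).

Definition wave_domain E c : Prop :=
  [\/ c ^+ 2 < 1 /\ `|E| < 1,
      c ^+ 2 < 1 /\ E < -1,
      1 < c ^+ 2 /\ `|E| < 1 |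
      1 < c ^+ 2 /\ 1 < E].

Definition wave_profile V E c g : Prop :=
  forall z, [/\ derivable g z 1,
                derivable (derive1 g) z 1,
                (c ^+ 2 - 1) * derive1n 2 g z + derive1 V (g z) = 0 &
                2^-1 * (c ^+ 2 - 1) * derive1 g z ^+ 2 = E - V (g z)].

(* On [wave_domain] the librational waves are exactly those with [`|E| < 1]. *)
Definition wave_shift E g T : Prop :=
  if `|E| < 1 then forall z, g (z + T) = g z
  else (forall z, g (z + T) = g z + 2 * pi) \/
       (forall z, g (z + T) = g z - 2 * pi).

Definition wave_period E g T : Prop :=
  [/\ 0 < T, wave_shift E g T &
      forall T', 0 < T' -> wave_shift E g T' -> T <= T'].

Definition periodic_traveling_wave V E c g T : Prop :=
  [/\ wave_profile V E c g,
      ~ (exists k, forall z, derive1 g z = k),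
      periodic (derive1 g) T &
      wave_period E g T].

(* [f E c] is the profile f( . ; E, c). *)
Definition normalized_waves V umin umax
    (f : R -> R -> R -> R) (T : R -> R -> R) : Prop :=
  forall E c, wave_domain E c ->
    [/\ periodic_traveling_wave V E c (f E c) (T E c),
        0 < derive1 (f E c) 0 &
        f E c 0 = if c ^+ 2 < 1 then umax else umin].

End Waves.

Section Index.
Context {R : realType}.
Implicit Types (V g : R -> R) (c T z lam : R).

Definition mx22 (K : Type) (a b c d : K) : 'M[K]_2 :=
  \matrix_(i, j) if i == 0 then (if j == 0 then a else b)
                 else (if j == 0 then c else d).

Definition hill_matrix V c g z lam : 'M[R]_2 :=
  mx22 0 1
       (- ((lam ^+ 2 + derive1n 2 V (g z)) / (c ^+ 2 - 1)))
       ((2 * c * lam) / (c ^+ 2 - 1)).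

(* The spectral parameter is taken real: the index only involves lam = 0,
   where the system and its solutions are real. *)
Definition fundamental_matrix V c g (F : R -> R -> 'M[R]_2) : Prop :=
  forall lam, F 0 lam = 1%:M /\
    forall z i j, is_derive z 1 (fun y => F y lam i j)
                            ((hill_matrix V c g z lam *m F z lam) i j).

Definition monodromy (F : R -> R -> 'M[R]_2) T lam : 'M[R]_2 := F T lam.

(* [M 0 1] is the entry M_12, indices being counted from 0. *)
Definition modulational_index (F : R -> R -> 'M[R]_2) T : R :=
  Num.sg (monodromy F T 0 0 1).

End Index.

Section Whitham.
Context {R : realType}.
Implicit Types (f : R -> R -> R -> R) (T : R -> R -> R) (E c : R).

Definition whithamW f T E c : R :=
  (c ^+ 2 - 1) *
  \int[lebesgue_measure]_(z in `[0, T E c]) derive1 (f E c) z ^+ 2.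

Definition whithamW_E f T E c : R := derive1 (whithamW f T ^~ c) E.

Definition whithamW_EE f T E c : R := derive1 (whithamW_E f T ^~ c) E.

Definition whitham_denom f T E c : R :=
  c ^+ 2 * whithamW_E f T E c ^+ 2 + whithamW f T E c * whithamW_EE f T E c.

Definition whitham_matrix f T E c : 'M[R]_2 :=
  let W := whithamW f T E c in
  let WE := whithamW_E f T E c in
  let WEE := whithamW_EE f T E c in
  (whitham_denom f T E c)^-1 *:
    mx22 ((WE ^+ 2 + W * WEE) * c)             (- (W * WE))
         ((c ^+ 2 - 1) ^+ 2 * WE * WEE)        ((WE ^+ 2 + W * WEE) * c).

Definition complex_eigenvalue (A : 'M[R]_2) (l : R[i]) : Prop :=
  eigenvalue (map_mx (real_complex R) A) l.

(* Type of the quasilinear system v_t + U(v) v_x = 0, v = (E, c), at a state.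
   Hyperbolicity is understood in the usual sense for first-order systems:
   real eigenvalues with a complete set of eigenvectors.  The completeness is
   not automatic for a double eigenvalue: when W_EE = 0 (which does occur, with
   index 0, e.g. for superluminal librations in a potential that is exactly
   quadratic near its minimum) the matrix above is a real Jordan block, and the
   system is neither hyperbolic nor elliptic. *)
Definition hyperbolic_at (U : R -> R -> 'M[R]_2) E c : Prop :=
  (forall l, complex_eigenvalue (U E c) l -> complex.Im l = 0) /\
  diagonalizable (U E c).

Definition elliptic_at (U : R -> R -> 'M[R]_2) E c : Prop :=
  exists l, [/\ complex.Im l != 0, complex_eigenvalue (U E c) l &
                complex_eigenvalue (U E c) (conjc l)].

End Whitham.

(* Main.v *)
Require Import Defs.
From mathcomp Require Import all_boot all_order all_algebra.
From mathcomp Require Import all_classical all_reals all_analysis.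
From mathcomp Require Import complex ring lra.
Import Order.TTheory GRing.Theory Num.Theory.
Local Open Scope ring_scope.

(** Write a for c ^ 2 - 1, v for the z-derivative of the profile y = f E c, and
    p for v(0).  Whitham's matrix has equal diagonal entries, so the square of
    the distance from an eigenvalue to the diagonal entry is the product of the
    off-diagonal entries, which is a positive multiple of - W * W_EE once
    W_E != 0.  The system is elliptic when that product is negative and
    hyperbolic when it is positive; when it vanishes the upper right entry is
    still nonzero and the matrix is a Jordan block, so the system is neither.
    It remains to identify signs, and this rests on two formulas:
      W_E = T   and   W_EE = T_E = - M_12(0) / (a * p ^ 2).
    As a * W > 0, they make the off-diagonal product a positive multiple of
    M_12(0) ([whitham_matrix_discriminant]).

    Formula for T_E ([period_derive]).  The profiles solve y'' = - V'(y) / a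
    from a fixed height, with an initial velocity that is smooth in E.  A
    Gronwall estimate shows that they depend differentiably on E, uniformly on
    bounded intervals, with derivative a solution w of the linearized equation
    that vanishes at 0 ([family_derive]).  At lambda = 0 the first-order system
    defining the index is that linearized equation, so that
    w(T) = M_12(0) / (a * p).  Differentiating y(T) = y(0) + shift in E gives
    T_E = - w(T) / p ([implicit_derive]).  This presupposes that T is continuous
    in E, although T is defined by minimality: by conservation of energy and
    uniqueness T is the first time at which the profile is back at its initial
    height, up to the shift, with its initial velocity.  A transversal return
    persists under perturbation, and compactness prevents an earlier one from
    appearing ([first_return_continuous]).

    Formula for W_E ([whithamW_derive]).  This one is needed at every energy
    near E, whereas the linearized solution is given only at E itself, so it is
    proved without differentiating the profile.  If y' and v' belong to the
    energy E + h, conservation of energy yields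
      a * (v' ^ 2 - v ^ 2) = h + (a * v * (y' - y))_z + O(h ^ 2),
    because the Lipschitz dependence on E bounds y' - y and v' - v by O(h).
    Integrating, the boundary term cancels to first order the contribution of
    the moving endpoint T(E + h), and h * T is left ([action_derive]). *)

Set Implicit Arguments.
Unset Strict Implicit.
Unset Printing Implicit Defensive.
Import numFieldNormedType.Exports.
Local Open Scope classical_set_scope.

(** * Derivatives and comparison for second-order equations *)

Lemma is_derive_cts (R : realType) (f : R -> R) (x df : R) :
  is_derive x 1 f df -> {for x, continuous f}.
Proof. by case=> /derivable1_diffP /differentiable_continuous. Qed.

Lemma is_derive_cts_in (R : realType) (f df : R -> R) (a b : R) :
  (forall x : R, a <= x <= b -> is_derive x 1 f (df x)) ->
  {within `[a, b], continuous f}.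
Proof.
move=> hf; apply: continuous_in_subspaceT => x; rewrite inE/= in_itv/= => xab.
exact: is_derive_cts (hf _ xab).
Qed.

Lemma gronwall (R : realType) (N dN : R -> R) (K Z : R) :
  (forall z : R, is_derive z 1 N (dN z)) ->
  (forall z : R, 0 <= z <= Z -> dN z <= K * N z) ->
  forall z : R, 0 <= z <= Z -> N z <= N 0 * expR (K * z).
Proof.
move=> hN hle z /andP[z0 zZ].
pose h x := N x * expR (- K * x).
have hd (x : R) : is_derive x 1 h ((dN x - K * N x) * expR (- K * x)).
  rewrite /h.
  by apply: is_derive_eq; rewrite /GRing.scale/=; ring.
have [|x] := @MVT_segment R h _ 0 z z0 (fun x _ => hd x).
  by apply: is_derive_cts_in => x _; exact: hd.
rewrite in_itv/= => /andP[x0 xz] hE.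
have : h z <= h 0.
  rewrite -subr_le0 hE subr0; apply: mulr_le0_ge0 => //.
  apply: mulr_le0_ge0; last exact: expR_ge0.
  by rewrite subr_le0 hle// x0 (le_trans xz).
rewrite /h mulr0 expR0 mulr1 mulNr expRN ler_pdivrMr ?expR_gt0//.
Qed.

(** Gronwall's inequality for the squared phase-space distance to the origin.
    Adding b ^ 2 to it absorbs the inhomogeneous term, so that one exponential
    bound covers the homogeneous and the forced case. *)
Lemma second_order_energy (R : realType) (q v dv : R -> R) (L b Z : R) :
  0 <= L -> 0 <= b ->
  (forall z : R, is_derive z 1 q (v z)) -> (forall z : R, is_derive z 1 v (dv z)) ->
  (forall z : R, 0 <= z <= Z -> `|dv z| <= L * `|q z| + b) ->
  forall z : R, 0 <= z <= Z ->
  q z ^+ 2 + v z ^+ 2 + b ^+ 2 <=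
    (q 0 ^+ 2 + v 0 ^+ 2 + b ^+ 2) * expR ((2 + L) * z).
Proof.
move=> L0 b0 hq hv hdv.
apply: (@gronwall _ (fun z => q z ^+ 2 + v z ^+ 2 + b ^+ 2)
  (fun z => 2 * q z * v z + 2 * v z * dv z)).
  by move=> z; apply: is_derive_eq; rewrite /GRing.scale/=; ring.
move=> z zZ.
have h1 : `|v z * dv z| <= `|v z| * (L * `|q z| + b).
  by rewrite normrM ler_wpM2l// hdv.
have h2 := ler_norm (v z * dv z).
rewrite -(real_normK (num_real (q z))) -(real_normK (num_real (v z))).
have h3 : q z * v z <= `|q z| * `|v z| by rewrite -normrM ler_norm.
set Q := `|q z| in h1 h3 *; set W := `|v z| in h1 h3 *.
have h4 : 0 <= (Q - W) ^+ 2 by exact: sqr_ge0.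
have h5 : 0 <= (W - b) ^+ 2 by exact: sqr_ge0.
have h6 : 0 <= L * (Q - W) ^+ 2 by exact: mulr_ge0.
have h7 : 0 <= L * b ^+ 2 by rewrite mulr_ge0// sqr_ge0.
have h8 : 0 <= b ^+ 2 by rewrite sqr_ge0.
have h9 : 0 <= Q ^+ 2 by rewrite sqr_ge0.
nra.
Qed.

(** A linear bound extracted from [second_order_energy]. With b = 0 it gives
    uniqueness and Lipschitz dependence; with b proportional to a small
    parameter it controls remainders. *)
Lemma second_order_bound (R : realType) (q v dv : R -> R) (L b Z : R) :
  0 <= L -> 0 <= b ->
  (forall z : R, is_derive z 1 q (v z)) -> (forall z : R, is_derive z 1 v (dv z)) ->
  (forall z : R, 0 <= z <= Z -> `|dv z| <= L * `|q z| + b) ->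
  forall z : R, 0 <= z <= Z ->
  `|q z| <= expR ((2 + L) * Z) * (`|q 0| + `|v 0| + b) /\
  `|v z| <= expR ((2 + L) * Z) * (`|q 0| + `|v 0| + b).
Proof.
move=> L0 b0 hq hv hdv z zZ.
have := second_order_energy L0 b0 hq hv hdv zZ.
have/andP[z0 zleZ] := zZ.
set C := expR ((2 + L) * Z).
have C1 : 1 <= C by rewrite -[1]expR0 ler_expR; apply: mulr_ge0; lra.
have eC : expR ((2 + L) * z) <= C by rewrite ler_expR ler_wpM2l//; lra.
have e0 := expR_ge0 ((2 + L) * z).
rewrite -(real_normK (num_real (q z))) -(real_normK (num_real (v z))).
rewrite -(real_normK (num_real (q 0))) -(real_normK (num_real (v 0))).
have := normr_ge0 (q 0); have := normr_ge0 (v 0).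
have := normr_ge0 (q z); have := normr_ge0 (v z).
move: (`|q z|) (`|v z|) (`|q 0|) (`|v 0|) => Q W q0 v0 Q0 W0 q00 v00 h.
set S := q0 + v0 + b.
have S0 : 0 <= S by rewrite /S; lra.
have h1 : Q ^+ 2 + W ^+ 2 <= (C * S) ^+ 2.
  apply: (@le_trans _ _ (S ^+ 2 * C)); last first.
    rewrite exprMn mulrC ler_wpM2r ?sqr_ge0// expr2 ler_peMr//; lra.
  have h2 : q0 ^+ 2 + v0 ^+ 2 + b ^+ 2 <= S ^+ 2 by rewrite /S; nra.
  apply: le_trans (_ : (q0 ^+ 2 + v0 ^+ 2 + b ^+ 2) * expR ((2 + L) * z) <= _).
    have := sqr_ge0 b; lra.
  by apply: ler_pM => //; rewrite !addr_ge0// sqr_ge0.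
have CS0 : 0 <= C * S by rewrite mulr_ge0//; lra.
by split; rewrite -(@ler_pXn2r _ 2)// ?nnegrE//; have := sqr_ge0 Q;
  have := sqr_ge0 W; lra.
Qed.

(** The form in which derivatives in the energy are consumed and produced:
    every estimate below is a bound by a small multiple of the increment. *)
Lemma is_derive_littleoP (R : realType) (f : R -> R) (x a : R) :
  is_derive x 1 f a <->
  (forall e, 0 < e -> \forall z \near x,
     `|f z - f x - (z - x) * a| <= e * `|z - x|).
Proof.
split=> [/is_derive1_caratheodory[g [fE gc ga]] e e0|hf].
  near=> z; rewrite fE (mulrC (g z)) -mulrBr normrM mulrC ler_wpM2r//.
  rewrite -ga distrC; near: z; move/cvgrPdist_le: gc; exact.
apply/is_derive1_caratheodory.
exists (fun z => if z == x then a else (f z - f x) / (z - x)); split.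
- move=> z; case: eqP => [->|/eqP]; first by rewrite !subrr mulr0.
  by rewrite -subr_eq0 => /divfK->.
- apply/cvgrPdist_le => e e0; rewrite eqxx.
  near=> z; case: eqP => [_|/eqP zx]; first by rewrite subrr normr0 ltW.
  have zx0 : z - x != 0 by rewrite subr_eq0.
  rewrite -(ler_pM2r (_ : 0 < `|z - x|)) ?normr_gt0//.
  rewrite -normrM mulrBl divfK// distrC (mulrC a).
  by near: z; exact: hf.
- by rewrite eqxx.
Unshelve. all: by end_near. Qed.

Lemma derive_bounded_lipschitz (R : realType) (g dg : R -> R) (L : R) :
  (forall x : R, is_derive x 1 g (dg x)) -> (forall x, `|dg x| <= L) ->
  forall x y, `|g x - g y| <= L * `|x - y|.
Proof.
move=> hg hL x y; wlog xy : x y / y <= x.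
  by move=> H; have [/H//|/ltW/H] := leP y x; rewrite distrC (distrC y).
have [|c _ ->] := @MVT_segment R g dg y x xy (fun z _ => hg z).
  by apply: is_derive_cts_in => z _; exact: hg.
by rewrite normrM ler_wpM2r.
Qed.

Lemma taylor1_le (R : realType) (g dg : R -> R) (u u' e : R) :
  (forall x : R, is_derive x 1 g (dg x)) ->
  (forall x, `|x - u| <= `|u' - u| -> `|dg x - dg u| <= e) ->
  `|g u' - g u - dg u * (u' - u)| <= e * `|u' - u|.
Proof.
move=> hg hdg.
have cts a b : {within `[a, b], continuous g}.
  by apply: is_derive_cts_in => z _; exact: hg.
have [uu'|/ltW u'u] := leP u u'.
- have [|c] := @MVT_segment R g dg u u' uu' (fun z _ => hg z) => [//|].
  rewrite in_itv/= => /andP[uc cu'] ->.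
  rewrite -mulrBl normrM ler_wpM2r// hdg//.
  by rewrite !ger0_norm ?subr_ge0// lerB.
- have [|c] := @MVT_segment R g dg u' u u'u (fun z _ => hg z) => [//|].
  rewrite in_itv/= => /andP[uc cu'] E.
  have -> : g u' - g u - dg u * (u' - u) = (dg c - dg u) * (u' - u).
    by rewrite mulrBl; congr (_ - _); rewrite -opprB E; ring.
  rewrite normrM ler_wpM2r// hdg//.
  by rewrite !ler0_norm ?subr_le0// lerN2 lerB.
Qed.

(** Continuity is uniform in a neighbourhood of the compact curve described by
    y on [0, Z]. *)
Lemma unif_cts_along (R : realType) (h y : R -> R) (Z e : R) :
  continuous h -> continuous y -> 0 < e ->
  \forall d \near 0^'+, forall z, 0 <= z <= Z ->
    forall x, `|x - y z| <= d -> `|h x - h (y z)| <= e.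
Proof.
move=> hc yc e0.
suff loc (z0 : R) : \forall z \near z0 & d \near 0^'+,
    forall x, `|x - y z| <= d -> `|h x - h (y z)| <= e.
  have rf : Filter (0 : R)^'+ by apply: at_right_proper_filter.
  have := (compact_near_coveringP _).1 (@segment_compact R 0 Z) R 0^'+
    (fun d z => forall x, `|x - y z| <= d -> `|h x - h (y z)| <= e) rf
    (fun z0 _ => loc z0).
  by apply: filterS => d hd z zZ; apply: hd; rewrite /= in_itv.
have e20 : 0 < e / 2 by rewrite divr_gt0.
have /cvgrPdist_le/(_ _ e20)/nbhs_ballP[r /= r0 hr] := hc (y z0).
have r20 : 0 < r / 3 by rewrite divr_gt0.
have yn : \forall z \near z0, `|y z0 - y z| <= r / 3.
  by have /cvgrPdist_le := yc z0; exact.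
near=> z d => x /= xd.
have h1 : `|y z0 - y z| <= r / 3 by near: z.
have h2 : d <= r / 3 by near: d; exact: nbhs_right_le.
have b1 : ball (y z0) r (y z) by apply: le_lt_trans h1 _; lra.
have b2 : ball (y z0) r x.
  rewrite /ball/= -(subrK (y z) (y z0)) -addrA.
  apply: le_lt_trans (ler_normD _ _) _.
  by rewrite (distrC _ x); apply: le_lt_trans (lerD h1 xd) _; lra.
have := hr _ b1; have := hr _ b2 => /= h3 h4.
rewrite -(subrK (h (y z0)) (h x)) -addrA.
by apply: le_trans (ler_normD _ _) _; rewrite distrC (le_trans (lerD h3 h4))//; lra.
Unshelve. all: by end_near. Qed.

(** * Dependence of solutions of y'' = G y on the initial velocity *)

Definition newton (R : realType) (G y v : R -> R) : Prop :=
  (forall z : R, is_derive z 1 y (v z)) /\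
  (forall z : R, is_derive z 1 v (G (y z))).

Lemma newton_close (R : realType) (G : R -> R) (L Z : R) (y1 v1 y2 v2 : R -> R) :
  (forall u u', `|G u - G u'| <= L * `|u - u'|) -> 0 <= L ->
  newton G y1 v1 -> newton G y2 v2 -> y1 0 = y2 0 ->
  forall z, 0 <= z <= Z ->
  `|y1 z - y2 z| <= expR ((2 + L) * Z) * `|v1 0 - v2 0| /\
  `|v1 z - v2 z| <= expR ((2 + L) * Z) * `|v1 0 - v2 0|.
Proof.
move=> hG L0 [dy1 dv1] [dy2 dv2] y12 z zZ.
have [|] := @second_order_bound R (fun z => y1 z - y2 z) (fun z => v1 z - v2 z)
  (fun z => G (y1 z) - G (y2 z)) L 0 Z L0 (lexx 0) _ _ _ z zZ.
- by move=> x _; rewrite addr0.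
- by rewrite y12 subrr normr0 add0r addr0.
Qed.

Lemma newton_rev (R : realType) (G y v : R -> R) :
  newton G y v -> newton G (fun z => y (- z)) (fun z => - v (- z)).
Proof.
move=> [dy dv]; split=> z; apply: is_derive_eq; rewrite /GRing.scale/=; ring.
Qed.

(** Negative times are reached by reversing time, which turns a solution into
    a solution. *)
Lemma newton_unique (R : realType) (G : R -> R) (L : R) (y1 v1 y2 v2 : R -> R) :
  (forall u u', `|G u - G u'| <= L * `|u - u'|) -> 0 <= L ->
  newton G y1 v1 -> newton G y2 v2 -> y1 0 = y2 0 -> v1 0 = v2 0 ->
  forall z, y1 z = y2 z.
Proof.
move=> hG L0 h1 h2 y12 v12.
have pos (g1 w1 g2 w2 : R -> R) : newton G g1 w1 -> newton G g2 w2 ->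
    g1 0 = g2 0 -> w1 0 = w2 0 -> forall z, 0 <= z -> g1 z = g2 z.
  move=> k1 k2 g12 w12 z z0.
  have zz : 0 <= z <= z by rewrite z0 lexx.
  have [] := newton_close hG L0 k1 k2 g12 zz.
  by rewrite w12 subrr normr0 mulr0 normr_le0 subr_eq0 => /eqP.
move=> z; have [z0|/ltW z0] := leP 0 z; first exact: pos h1 h2 y12 v12 z z0.
rewrite -(opprK z); apply: (pos _ _ _ _ (newton_rev h1) (newton_rev h2)).
- by rewrite oppr0.
- by rewrite oppr0 v12.
- by rewrite oppr_ge0.
Qed.

Lemma continuous_bounded (R : realType) (w : R -> R) (Z : R) :
  continuous w -> 0 <= Z -> exists2 M, 0 <= M & forall z, 0 <= z <= Z -> `|w z| <= M.
Proof.
move=> wc Z0.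
have [|c cZ cmax] := @EVT_max R (fun z => `|w z|) 0 Z Z0.
  by apply: continuous_subspaceT => z; apply: continuous_comp;
    [exact: wc|exact: norm_continuous].
by exists `|w c| => // z zZ; apply: cmax; rewrite in_itv.
Qed.

Definition uniform_lipschitz (R : realType) (g : R -> R -> R) (E Z : R) : Prop :=
  exists2 C, 0 < C & \forall E' \near E, forall z, 0 <= z <= Z ->
    `|g E' z - g E z| <= C * `|E' - E|.

(** Differentiability of the family g at E, uniformly for z in [0, Z], with
    derivative b. *)
Definition uniform_derive (R : realType) (g : R -> R -> R) (b : R -> R) (E Z : R)
    : Prop :=
  forall e, 0 < e -> \forall E' \near E, forall z, 0 <= z <= Z ->
    `|g E' z - g E z - (E' - E) * b z| <= e * `|E' - E|.

Section Family.
Context (R : realType) (G dG : R -> R) (L : R).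
Hypothesis dGE : forall x : R, is_derive x 1 G (dG x).
Hypothesis dGL : forall x, `|dG x| <= L.
Context (y v : R -> R -> R) (E k : R).
Hypothesis yvE : \forall E' \near E, newton G (y E') (v E') /\ y E' 0 = y E 0.
Hypothesis v0E : is_derive E 1 (v ^~ 0) k.

Let L0 : 0 <= L. Proof. exact: le_trans (normr_ge0 _) (dGL 0). Qed.
Let GL := derive_bounded_lipschitz dGE dGL.

Lemma family_lipschitz Z :
  uniform_lipschitz y E Z /\ uniform_lipschitz v E Z.
Proof.
pose C := expR ((2 + L) * Z) * (`|k| + 1).
have C0 : 0 < C by rewrite mulr_gt0 ?expR_gt0// ltr_wpDl.
have nv0 : \forall E' \near E, `|v E' 0 - v E 0| <= (`|k| + 1) * `|E' - E|.
  have /is_derive_littleoP/(_ 1 ltr01) := v0E; apply: filterS => E' h.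
  rewrite -(subrK ((E' - E) * k) (v E' 0 - v E 0)).
  apply: le_trans (ler_normD _ _) _; rewrite normrM.
  by rewrite [leRHS]mulrDl addrC [_ * `|k|]mulrC lerD.
suff key : \forall E' \near E, forall z, 0 <= z <= Z ->
    `|y E' z - y E z| <= C * `|E' - E| /\ `|v E' z - v E z| <= C * `|E' - E|.
  by split; exists C => //; apply: filterS key => E' h z /h[].
have [sE _] := nbhs_singleton yvE.
near=> E' => z zZ.
have [sE' y0] : newton G (y E') (v E') /\ y E' 0 = y E 0 by near: E'.
have h : `|v E' 0 - v E 0| <= (`|k| + 1) * `|E' - E| by near: E'.
have [h1 h2] := newton_close GL L0 sE' sE y0 zZ.
by rewrite /C -mulrA; split; (apply: le_trans; [exact: h1 || exact: h2|]);
  rewrite ler_wpM2l// expR_ge0.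
Unshelve. all: by end_near. Qed.

(** The remainder q = y E' - y E - (E' - E) w satisfies the linearized
    equation up to the Taylor remainder of G, which is small compared with y
    E' - y E, hence with E' - E by [family_lipschitz]. Then
    [second_order_bound] applies to q. *)
Lemma family_derive (w w1 : R -> R) Z :
  continuous dG ->
  (forall z : R, is_derive z 1 w (w1 z)) ->
  (forall z : R, is_derive z 1 w1 (dG (y E z) * w z)) ->
  w 0 = 0 -> w1 0 = k -> uniform_derive y w E Z.
Proof.
move=> dGc dw dw1 w0 w10 e e0.
have [[C C0 yC] _] := family_lipschitz Z.
have [sE _] := nbhs_singleton yvE.
pose B := expR ((2 + L) * Z) * (1 + C).
have B0 : 0 < B by rewrite mulr_gt0 ?expR_gt0// addr_gt0.
pose t := e / B.
have t0 : 0 < t by rewrite divr_gt0.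
have yEc : continuous (y E) by move=> z; exact: is_derive_cts (sE.1 z).
have [d d0 hd] : exists2 d, 0 < d & forall z, 0 <= z <= Z ->
    forall x, `|x - y E z| <= d -> `|dG x - dG (y E z)| <= t.
  near (0 : R)^'+ => d; exists d => //.
  by near: d; exact: unif_cts_along.
near=> E' => z zZ.
have [sE' y0] : newton G (y E') (v E') /\ y E' 0 = y E 0 by near: E'.
have close x : 0 <= x <= Z -> `|y E' x - y E x| <= C * `|E' - E|.
  by move: x; near: E'.
have small : C * `|E' - E| <= d.
  rewrite -ler_pdivlMl// mulrC distrC; near: E'.
  by apply: (@cvgr_dist_le _ _ _ (nbhs E) _ id E) => //; exact: divr_gt0.
have v0 : `|v E' 0 - v E 0 - (E' - E) * k| <= t * `|E' - E|.
  near: E'.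
  exact: (iffLR (is_derive_littleoP _ _ _) v0E _ t0).
pose q x := y E' x - y E x - (E' - E) * w x.
pose q1 x := v E' x - v E x - (E' - E) * w1 x.
pose q2 x := G (y E' x) - G (y E x) - (E' - E) * (dG (y E x) * w x).
have [dy dv] := sE; have [dy' dv'] := sE'.
have dq (x : R) : is_derive x 1 q (q1 x).
  by apply: is_derive_eq; rewrite /GRing.scale/=; rewrite /q1; ring.
have dq1 (x : R) : is_derive x 1 q1 (q2 x).
  by apply: is_derive_eq; rewrite /GRing.scale/=; rewrite /q2; ring.
have b0 : 0 <= t * (C * `|E' - E|).
  by apply: mulr_ge0; [exact: ltW|apply: mulr_ge0 => //; exact: ltW].
have [|h _] := @second_order_bound R q q1 q2 L (t * (C * `|E' - E|)) Z L0 b0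
  dq dq1 _ z zZ.
  move=> x xZ.
  have -> : q2 x = dG (y E x) * q x +
      (G (y E' x) - G (y E x) - dG (y E x) * (y E' x - y E x)).
    by rewrite /q2 /q; ring.
  apply: le_trans (ler_normD _ _) _; rewrite normrM lerD//.
    by rewrite ler_wpM2r.
  apply: le_trans (_ : t * `|y E' x - y E x| <= _); last first.
    by rewrite ler_wpM2l ?close// ltW.
  apply: taylor1_le => // u hu; apply: hd => //.
  by rewrite (le_trans hu)// (le_trans (close _ xZ)).
apply: le_trans h _.
have -> : q 0 = 0 by rewrite /q y0 w0; ring.
rewrite normr0 add0r /q1 w10.
apply: (@le_trans _ _ (expR ((2 + L) * Z) *
  (t * `|E' - E| + t * (C * `|E' - E|)))).
  by rewrite ler_wpM2l ?expR_ge0// lerD2r.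
have -> : e = t * B by rewrite /t divfK// gt_eqF.
by rewrite le_eqVlt; apply/orP; left; apply/eqP; rewrite /B; ring.
Unshelve. all: by end_near. Qed.
End Family.

(** * Implicitly defined times *)

(** Only continuity of tau is assumed: the slope of y E between tau E and tau
    E' tends to k, and dividing by this slope expresses tau E' - tau E through
    E' - E. *)
Lemma implicit_derive (R : realType) (y : R -> R -> R) (w tau : R -> R)
    (E Z k : R) :
  uniform_derive y w E Z -> 0 < tau E < Z -> {for E, continuous tau} ->
  (\forall E' \near E, y E' (tau E') = y E (tau E)) ->
  is_derive (tau E) 1 (y E) k -> k != 0 -> {for tau E, continuous w} ->
  is_derive E 1 tau (- w (tau E) / k).
Proof.
move=> yw tauZ tauc tauE /is_derive1_caratheodory[s [sE sc sk]] k0 wc.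
(* the relative remainder; at E' = E the quotient by 0 takes the value 0 *)
pose r E' := (y E' (tau E') - y E (tau E') - (E' - E) * w (tau E')) / (E' - E).
have r0 : r E = 0 by rewrite /r [X in _ / X]subrr invr0 mulr0.
have inZ : \forall E' \near E, 0 <= tau E' <= Z.
  have /andP[t0 tZ] := tauZ.
  near=> E'; apply/andP; split; near: E'.
  - by apply: (cvgr_ge _ tauc).
  - by apply: (cvgr_le _ tauc).
have rc : {for E, continuous r}.
  apply/cvgrPdist_le => e e0; rewrite r0; near=> E'.
  rewrite sub0r normrN; have [->|E'E] := eqVneq E' E.
    by rewrite r0 normr0 ltW.
  rewrite /r normrM normfV ler_pdivrMr ?normr_gt0 ?subr_eq0//.
  have h : forall z, 0 <= z <= Z ->
    `|y E' z - y E z - (E' - E) * w z| <= e * `|E' - E| by near: E'; exact: yw.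
  by apply: h; near: E'.
have stc : {for E, continuous (s \o tau)} by exact: continuous_comp.
have wtc : {for E, continuous (w \o tau)} by exact: continuous_comp.
pose H E' := - (w (tau E') + r E') / s (tau E').
have Hc : {for E, continuous H}.
  apply: (@continuousM _ _ (fun E' => - (w (tau E') + r E'))
    (fun E' => (s (tau E'))^-1)).
    by apply: continuousN; exact: continuousD.
  by apply: continuousV => //; rewrite sk.
have HE : H E = - w (tau E) / k by rewrite /H r0 addr0 sk.
apply: (@near_eq_is_derive _ _ _ (fun E' => tau E + H E' * (E' - E))).
  near=> E'.
  have [->|E'E] := eqVneq E' E; first by rewrite subrr mulr0 addr0.
  have st0 : s (tau E') != 0.
    by near: E'; apply: (cvgr_neq0 _ stc); rewrite /= sk.
  have e1 := sE (tau E').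
  have e2 : y E' (tau E') = y E (tau E) by near: E'.
  have e3 : r E' * (E' - E) =
      y E' (tau E') - y E (tau E') - (E' - E) * w (tau E').
    by rewrite /r divfK// subr_eq0.
  apply: (mulfI st0); rewrite mulrDr /H mulrA mulrCA divff// mulr1.
  rewrite mulNr mulrDl e3 e2.
  have -> : y E (tau E') = y E (tau E) + s (tau E') * (tau E' - tau E).
    by rewrite -e1; ring.
  by ring.
apply/is_derive1_caratheodory; exists H; split=> // z.
by rewrite subrr; ring.
Unshelve. all: by end_near. Qed.

Lemma implicit_lipschitz (R : realType) (y : R -> R -> R) (tau : R -> R)
    (E Z k : R) :
  uniform_lipschitz y E Z -> 0 < tau E < Z -> {for E, continuous tau} ->
  (\forall E' \near E, y E' (tau E') = y E (tau E)) ->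
  is_derive (tau E) 1 (y E) k -> k != 0 ->
  exists2 C, 0 < C & \forall E' \near E, `|tau E' - tau E| <= C * `|E' - E|.
Proof.
move=> [C C0 yC] /andP[t0 tZ] tauc tauE /is_derive1_caratheodory[s [sE sc sk]] k0.
have stc : {for E, continuous (s \o tau)} by exact: continuous_comp.
have nk0 : 0 < `|k| by rewrite normr_gt0.
exists (C / (`|k| / 2)); first by rewrite !divr_gt0.
near=> E'.
have hs : `|k| / 2 <= `|s (tau E')|.
  near: E'; apply: (cvgr_norm_ge _ stc); rewrite /= sk; lra.
rewrite mulrAC ler_pdivlMr ?divr_gt0//.
apply: le_trans (_ : `|s (tau E') * (tau E' - tau E)| <= _).
  by rewrite normrM mulrC ler_wpM2r.
rewrite -sE.
have <- : y E' (tau E') = y E (tau E) by near: E'.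
rewrite distrC.
have h : forall z, 0 <= z <= Z -> `|y E' z - y E z| <= C * `|E' - E| by near: E'.
apply: h; apply/andP; split; near: E'.
- by apply: (cvgr_ge _ tauc).
- by apply: (cvgr_le _ tauc).
Unshelve. all: by end_near. Qed.

Lemma uniform_lipschitz_close (R : realType) (g : R -> R -> R) (E Z e : R) :
  uniform_lipschitz g E Z -> 0 < e ->
  \forall E' \near E, forall z, 0 <= z <= Z -> `|g E' z - g E z| <= e.
Proof.
move=> [C C0 gC] e0; near=> E' => z zZ.
have h : forall z, 0 <= z <= Z -> `|g E' z - g E z| <= C * `|E' - E| by near: E'.
apply: le_trans (h z zZ) _.
rewrite -ler_pdivlMl// mulrC distrC; near: E'.
by apply: (@cvgr_dist_le _ _ _ (nbhs E) _ id E) => //; exact: divr_gt0.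
Unshelve. all: by end_near. Qed.

(** * Continuity of the time of first return *)

(** A transversal crossing of the level a persists: g gains more than k on
    either side of T, so g' takes the value a nearby, and its velocity there
    stays positive. *)
Lemma perturbed_return (R : realType) (g h g' h' : R -> R) (a p k d T : R) :
  (forall z : R, is_derive z 1 g (h z)) ->
  (forall z : R, is_derive z 1 g' (h' z)) ->
  0 < d -> k < p * d / 2 -> k < p / 2 -> g T = a ->
  (forall z, `|T - z| <= d -> p / 2 <= h z) ->
  (forall z, `|T - z| <= d -> `|g' z - g z| <= k /\ `|h' z - h z| <= k) ->
  exists2 z, `|T - z| <= d & g' z = a /\ 0 < h' z.
Proof.
move=> dg dg' d0 kpd kp gT hh clo.
have cts : {within `[T - d, T + d], continuous g'}.
  by apply: is_derive_cts_in => z _; exact: dg'.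
have nT z : T - d <= z <= T + d -> `|T - z| <= d.
  by move=> ?; rewrite ler_norml; lra.
have lo : g' (T - d) <= a.
  have Td : T - d <= T by lra.
  have [|x] := @MVT_segment R _ _ _ _ Td (fun z _ => dg z).
    by apply: is_derive_cts_in => z _; exact: dg.
  rewrite in_itv/= gT => /andP[x1 x2] hx.
  have h1 : p / 2 <= h x by apply/hh/nT; lra.
  have h2 : 0 <= (h x - p / 2) * d by apply: mulr_ge0; lra.
  have [+ _] : `|g' (T - d) - g (T - d)| <= k /\ `|h' (T - d) - h (T - d)| <= k.
    by apply/clo/nT; lra.
  rewrite ler_norml => /andP[_]; clear -hx h2 kpd; lra.
have hi : a <= g' (T + d).
  have Td : T <= T + d by lra.
  have [|x] := @MVT_segment R _ _ _ _ Td (fun z _ => dg z).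
    by apply: is_derive_cts_in => z _; exact: dg.
  rewrite in_itv/= gT => /andP[x1 x2] hx.
  have h1 : p / 2 <= h x by apply/hh/nT; lra.
  have h2 : 0 <= (h x - p / 2) * d by apply: mulr_ge0; lra.
  have [+ _] : `|g' (T + d) - g (T + d)| <= k /\ `|h' (T + d) - h (T + d)| <= k.
    by apply/clo/nT; lra.
  rewrite ler_norml => /andP[+ _]; clear -hx h2 kpd; lra.
have Tdd : T - d <= T + d by lra.
have [|z] := @IVT R g' _ _ a Tdd cts.
  by rewrite ge_min lo/= le_max hi orbT.
rewrite in_itv/= => zT gz; exists z; first exact: nT.
split=> //; have := hh z (nT _ zT); have [_] := clo z (nT _ zT).
rewrite ler_norml => /andP[+ _]; lra.
Qed.

(** While the velocity is in (0, 2 p] the orbit moves, but by at most 2 p d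
    before time d: too little for a positive shift s, and not at all
    compatible with the shift 0. *)
Lemma no_fast_return (R : realType) (g h : R -> R) (s p d t : R) :
  (forall z : R, is_derive z 1 g (h z)) ->
  0 < t <= d -> (forall z, 0 <= z <= d -> 0 < h z <= 2 * p) ->
  s = 0 \/ 2 * p * d < s -> g t != g 0 + s.
Proof.
move=> dg /andP[t0 td] hh ds; apply/eqP => gt.
have [|x] := @MVT_segment R _ _ _ _ (ltW t0) (fun z _ => dg z).
  by apply: is_derive_cts_in => z _; exact: dg.
rewrite in_itv/= gt => /andP[x1 x2] hx.
have /hh/andP[h1 h2] : 0 <= x <= d by lra.
have hs : s = h x * t by lra.
case: ds => [s00|ds].
  by move: hs; rewrite s00 => /esym/eqP; rewrite mulf_eq0 !gt_eqF.
have c1 : 0 <= h x * (d - t) by apply: mulr_ge0; lra.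
have c2 : 0 <= (2 * p - h x) * d by apply: mulr_ge0; lra.
by lra.
Qed.

(** By compactness an orbit that does not return during [l, r] stays at a
    positive distance from returning. The factor 2 leaves room for perturbing
    both the velocity at time z and the initial velocity. *)
Lemma no_middle_return (R : realType) (g h : R -> R) (a p l r : R) :
  continuous g -> continuous h -> l <= r ->
  (forall z, l <= z <= r -> ~ (g z = a /\ h z = p)) ->
  exists2 k, 0 < k & forall z, l <= z <= r ->
    ~ (`|a - g z| <= k /\ `|p - h z| <= 2 * k).
Proof.
move=> gc hc lr nret.
pose m z := (g z - a) ^+ 2 + (h z - p) ^+ 2.
have mc : continuous m.
  move=> z; apply: (@continuousD _ _ _ (fun z => (g z - a) ^+ 2)
    (fun z => (h z - p) ^+ 2)).
    apply: (@continuous_comp _ _ _ (fun z => g z - a) (fun x => x ^+ 2)).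
      by apply: continuousB; [exact: gc|exact: cst_continuous].
    exact: exprn_continuous.
  apply: (@continuous_comp _ _ _ (fun z => h z - p) (fun x => x ^+ 2)).
    by apply: continuousB; [exact: hc|exact: cst_continuous].
  exact: exprn_continuous.
have [|c clr cmin] := @EVT_min R m l r lr.
  exact: continuous_subspaceT.
have mc0 : 0 < m c.
  rewrite lt_def addr_ge0 ?sqr_ge0// andbT; apply/negP.
  rewrite paddr_eq0 ?sqr_ge0// !sqrf_eq0 !subr_eq0 => /andP[/eqP h1 /eqP h2].
  by apply: (nret c) => //; move: clr; rewrite in_itv.
have [k k0 km] : exists2 k, 0 < k & 5 * k ^+ 2 < m c.
  near (0 : R)^'+ => k; exists k => //.
  have h1 : k < m c / 5 by near: k; apply: nbhs_right_lt; lra.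
  have h2 : k <= 1 by near: k; apply: nbhs_right_le; lra.
  have h3 : k ^+ 2 <= k by rewrite expr2 ler_piMl.
  by clear -h1 h3; lra.
exists k => // z zlr [].
have := cmin z; rewrite in_itv/= zlr => /(_ isT) mz.
rewrite !ler_norml => /andP[a1 a2] /andP[a3 a4].
have b1 : (g z - a) ^+ 2 <= k ^+ 2.
  by rewrite -subr_ge0 subr_sqr; apply: mulr_ge0; lra.
have b2 : (h z - p) ^+ 2 <= (2 * k) ^+ 2.
  by rewrite -subr_ge0 subr_sqr; apply: mulr_ge0; lra.
rewrite /m in mz km; clear -mz km b1 b2; lra.
Unshelve. all: by end_near. Qed.

(** Being back in the initial state, up to the translation by s that
    distinguishes rotations (s = 2 pi) from librations (s = 0). *)
Definition returns (R : realType) (g h : R -> R) (s z : R) : Prop :=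
  g z = g 0 + s /\ h z = h 0.

(** Near E, the first return time cannot be small ([no_fast_return]), cannot
    fall between d and T - d ([no_middle_return]), and is at most T + d
    ([perturbed_return]). The last fact uses that velocities at the level of
    return agree up to sign, which is conservation of energy. *)
Lemma first_return_continuous (R : realType) (y v : R -> R -> R) (tau : R -> R)
    (E s : R) :
  (forall Z, uniform_lipschitz y E Z) -> (forall Z, uniform_lipschitz v E Z) ->
  0 <= s ->
  (\forall E' \near E,
    [/\ forall z : R, is_derive z 1 (y E') (v E' z), continuous (v E'),
        y E' 0 = y E 0, 0 < v E' 0 &
        forall z, y E' z = y E' 0 + s -> v E' z ^+ 2 = v E' 0 ^+ 2]) ->
  (\forall E' \near E,
    [/\ 0 < tau E', returns (y E') (v E') s (tau E') &
        forall z, 0 < z -> returns (y E') (v E') s z -> tau E' <= z]) ->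
  {for E, continuous tau}.
Proof.
move=> yL vL s0 hyv htau.
have [dy vc _ p0 _] := nbhs_singleton hyv.
have [T0 [yT vT] Tmin] := nbhs_singleton htau.
have yc : continuous (y E) by move=> z; exact: is_derive_cts (dy z).
apply/cvgrPdist_le => e e0.
move: (tau E) T0 yT vT Tmin => T T0 yT vT Tmin.
pose p := v E 0; rewrite -/p in p0 vT.
have p4 : 0 < p / 4 by lra.
have [d [d0 dT de ds [hT h0]]] : exists d, [/\ 0 < d, d <= T / 3, d <= e,
    s = 0 \/ 2 * p * d < s &
    (forall z, `|T - z| <= d -> `|p - v E z| <= p / 4) /\
    (forall z, `|0 - z| <= d -> `|p - v E z| <= p / 4)].
  have /nbhs_ballP[a /= a0 ha] : \forall z \near T, `|p - v E z| <= p / 4.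
    by have /cvgrPdist_le := vc T; rewrite vT; exact.
  have /nbhs_ballP[b /= b0 hb] : \forall z \near (0 : R), `|p - v E z| <= p / 4.
    by have /cvgrPdist_le := vc 0; exact.
  have [g g0 hg] : exists2 g, 0 < g & s = 0 \/ forall d, d < g -> 2 * p * d < s.
    have [->|sn0] := eqVneq s 0; first by exists 1 => //; left.
    have sp : 0 < s by rewrite lt_def sn0.
    exists (s / (2 * p)); first by apply: divr_gt0 => //; lra.
    by right=> d; rewrite ltr_pdivlMr ?(mulrC d)//; lra.
  near (0 : R)^'+ => d; exists d; split=> //.
  - by near: d; apply: nbhs_right_le; lra.
  - by near: d; exact: nbhs_right_le.
  - case: (hg) => [|hg']; [by left|right; apply: hg'].
    by near: d; exact: nbhs_right_lt.
  - split=> z zd.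
      by apply: ha; apply: le_lt_trans zd _; near: d; exact: nbhs_right_lt.
    by apply: hb; apply: le_lt_trans zd _; near: d; exact: nbhs_right_lt.
have [|z zd [yz vz]|k1 k10 hk1] :=
  @no_middle_return R (y E) (v E) (y E 0 + s) p d (T - d) yc vc.
- by lra.
- by have := Tmin z; rewrite /returns yz vz => /(_ _ (conj erefl erefl)) h; lra.
(* k is the tolerance on the perturbed orbit: below k1 for the middle part,
   below p / 4 to keep velocities positive, and below p * d / 4 to cross the
   level of return inside [T - d, T + d] *)
pose k := Num.min k1 (Num.min (p / 4) (p * d / 4)).
have k0 : 0 < k.
  by rewrite !lt_min k10 p4 divr_gt0// mulr_gt0.
have kk1 : k <= k1 by rewrite ge_min lexx.
have kp : k <= p / 4 by rewrite !ge_min lexx orbT.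
have kpd : k <= p * d / 4 by rewrite !ge_min lexx !orbT.
suff final (g h : R -> R) (t : R) : (forall z : R, is_derive z 1 g (h z)) ->
    g 0 = y E 0 -> 0 < h 0 ->
    (forall z, g z = g 0 + s -> h z ^+ 2 = h 0 ^+ 2) ->
    0 < t -> returns g h s t ->
    (forall z, 0 < z -> returns g h s z -> t <= z) ->
    (forall z, 0 <= z <= T + d -> `|g z - y E z| <= k) ->
    (forall z, 0 <= z <= T + d -> `|h z - v E z| <= k) -> `|T - t| <= e.
  near=> E'.
  have [dy' vc' y0' p0' en'] : [/\ forall z : R, is_derive z 1 (y E') (v E' z),
    continuous (v E'), y E' 0 = y E 0, 0 < v E' 0 &
    forall z, y E' z = y E' 0 + s -> v E' z ^+ 2 = v E' 0 ^+ 2] by near: E'.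
  have [t0' ret' tmin'] : [/\ 0 < tau E', returns (y E') (v E') s (tau E') &
    forall z, 0 < z -> returns (y E') (v E') s z -> tau E' <= z] by near: E'.
  apply: (final (y E') (v E')) => //; near: E'; exact: uniform_lipschitz_close.
move=> {hyv htau yL vL} dy' y0' p0' en' t0' [yt' vt'] tmin' yk vk.
have pE : v E 0 = p by [].
clearbody k p.
have pd0 : 0 < p * d by exact: mulr_gt0.
have tle : t <= T + d.
  have kpd' : k < p * d / 2 by lra.
  have kp' : k < p / 2 by lra.
  have vT' z : `|T - z| <= d -> p / 2 <= v E z.
    by move=> /hT; rewrite ler_norml; lra.
  have clo z : `|T - z| <= d -> `|g z - y E z| <= k /\ `|h z - v E z| <= k.
    rewrite ler_norml => zT; have zZ : 0 <= z <= T + d by lra.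
    by split; [exact: yk|exact: vk].
  have [z zT [gz hz]] := perturbed_return dy dy' d0 kpd' kp' yT vT' clo.
  move: zT; rewrite ler_norml => zT.
  have z0 : 0 < z by lra.
  suff : t <= z by lra.
  apply: tmin' => //; split; first by rewrite y0'.
  apply/eqP; rewrite -(@eqrXn2 _ 2)// ?ltW//.
  by apply/eqP/en'; rewrite y0'.
have [td|td] := leP t d.
  exfalso; apply: (elimN eqP _ yt').
  apply: (@no_fast_return _ g h s p d t dy') => //.
    by rewrite t0' td.
  move=> z zd.
  have : `|h z - v E z| <= k by apply: vk; lra.
  have : `|p - v E z| <= p / 4 by apply: h0; rewrite ler_norml; lra.
  by rewrite !ler_norml; lra.
have [tT|tT] := leP t (T - d); last by rewrite ler_norml; lra.
exfalso; apply: (hk1 t); first by rewrite ltW.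
split; first by rewrite -y0' -yt' (le_trans (yk _ _))//; lra.
have : `|h 0 - v E 0| <= k by apply: vk; lra.
have : `|h t - v E t| <= k by apply: vk; lra.
rewrite vt' pE !ler_norml; lra.
Unshelve. all: by end_near. Qed.

(** * Primitives, periodic functions and the action integral *)

(** The base point -1 makes the primitive differentiable at both ends of every
    interval [0, b]. *)
Lemma continuous_primitive (R : realType) (g : R -> R) : continuous g ->
  exists J : R -> R, (forall z : R, -1 < z -> is_derive z 1 J (g z)) /\
    forall b, 0 < b -> \int[lebesgue_measure]_(z in `[0, b]) g z = J b - J 0.
Proof.
move=> gc.
pose J (x : R) := (\int[lebesgue_measure]_(t in `[-1, x]) g t).
have dJ (z : R) : -1 < z -> is_derive z 1 J (g z).
  move=> z1; have zz : z < z + 1 by lra.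
  have [||d1 d2] := @continuous_FTC1_closed R g (-1) z (z + 1) zz _ z1.
  - apply: continuous_compact_integrable; first exact: segment_compact.
    exact: continuous_subspaceT.
  - exact: gc.
  - by split; [exact: d1|rewrite -derive1E].
exists J; split=> // b b0; rewrite /Rintegral (@continuous_FTC2 R g J 0 b b0)//.
- exact: continuous_subspaceT.
- split.
  + move=> x; rewrite in_itv/= => /andP[x0 _].
    by have [] : is_derive x 1 J (g x) by apply: dJ; lra.
  + apply: cvg_at_right_filter; apply: (@is_derive_cts _ _ _ (g 0)); apply: dJ; lra.
  + apply: cvg_at_left_filter; apply: (@is_derive_cts _ _ _ (g b)); apply: dJ; lra.
- move=> x; rewrite in_itv/= => /andP[x0 _].
  by rewrite derive1E; have [_ ->] : is_derive x 1 J (g x) by apply: dJ; lra.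
Qed.

Lemma periodicz (R : realType) (g : R -> R) (p : R) : periodic g p ->
  forall (n : int) u, g (u + p *~ n) = g u.
Proof.
move=> gp [n|n] u; first by rewrite -pmulrn periodicn.
by rewrite NegzE -[in RHS](subrK (p *+ n.+1) u) (periodicn gp) mulrNz pmulrn.
Qed.

Lemma periodic_bounded (R : realType) (g : R -> R) (p : R) :
  0 < p -> periodic g p -> continuous g -> exists M, forall u, `|g u| <= M.
Proof.
move=> p0 gp gc; have [M _ hM] := continuous_bounded gc (ltW p0).
exists M => u; rewrite -(periodicz gp (- Num.floor (u / p))); apply: hM.
have := floor_itv (u / p).
rewrite mulrNz -mulrzl.
move: (Num.floor (u / p)) => n /andP[n1 n2].
move: n1 n2; rewrite ler_pdivlMr// ltr_pdivrMr// intrD mulrDl mul1r.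
by lra.
Qed.

Lemma periodic_derive1 (R : realType) (g : R -> R) (p : R) :
  (forall x, derivable g x 1) -> periodic g p -> periodic (derive1 g) p.
Proof.
move=> dg gp u; rewrite !derive1E.
have d1 : is_derive (u + p) 1 g ('D_1 g (u + p)) by exact/derivableP.
have : is_derive u 1 (fun x => g (x + p)) ('D_1 g (u + p)).
  by apply: is_derive_eq; rewrite /GRing.scale/=; ring.
have -> : (fun x => g (x + p)) = g by apply/funext => x; exact: gp.
by case.
Qed.

Section Action.
Context (R : realType) (V dV ddV : R -> R) (L a : R).
Hypothesis dVE : forall x : R, is_derive x 1 V (dV x).
Hypothesis ddVE : forall x : R, is_derive x 1 dV (ddV x).
Hypothesis ddVL : forall x, `|ddV x| <= L.
Context (y v J : R -> R -> R) (E : R).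
Hypothesis a0 : a != 0.
Hypothesis waveE : \forall E' \near E,
  [/\ forall z : R, is_derive z 1 (y E') (v E' z),
      forall z : R, is_derive z 1 (v E') (- dV (y E' z) / a),
      forall z, 2^-1 * a * v E' z ^+ 2 = E' - V (y E' z),
      y E' 0 = y E 0 &
      forall z : R, -1 < z -> is_derive z 1 (J E') (v E' z ^+ 2)].
Hypothesis yL : forall Z, uniform_lipschitz y E Z.
Hypothesis vL : forall Z, uniform_lipschitz v E Z.

(** The z-derivative of the expression inside the norm is a / 2 * (v E' - v E)
    ^ 2 minus the first-order Taylor remainder of V between y E and y E'. This
    follows from the conservation of energy for both orbits, and both terms
    are O((E' - E) ^ 2). *)
Lemma action_expansion Z e : 0 < e -> \forall E' \near E, forall z, 0 <= z <= Z ->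
  `|a * (J E' z - J E' 0) - a * (J E z - J E 0) - (E' - E) * z
     - a * v E z * (y E' z - y E z)| <= e * `|E' - E|.
Proof.
move=> e0.
have [C C0 yC] := yL Z; have [C' C'0 vC] := vL Z.
have [dy dv en _ dJ] := nbhs_singleton waveE.
have L0 : 0 <= L by exact: le_trans (ddVL 0).
pose K := L * C ^+ 2 + `|a| / 2 * C' ^+ 2.
have K0 : 0 <= K.
  by rewrite addr_ge0// mulr_ge0 ?sqr_ge0// divr_ge0.
have c0 : 0 < K * `|Z| + 1 by rewrite ltr_wpDl ?mulr_ge0.
near=> E' => z zZ.
have [dy' dv' en' y0 dJ'] : [/\ forall z : R, is_derive z 1 (y E') (v E' z),
      forall z : R, is_derive z 1 (v E') (- dV (y E' z) / a),
      forall z, 2^-1 * a * v E' z ^+ 2 = E' - V (y E' z),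
      y E' 0 = y E 0 &
      forall z : R, -1 < z -> is_derive z 1 (J E') (v E' z ^+ 2)] by near: E'.
have yk : forall z, 0 <= z <= Z -> `|y E' z - y E z| <= C * `|E' - E|.
  by near: E'.
have vk : forall z, 0 <= z <= Z -> `|v E' z - v E z| <= C' * `|E' - E|.
  by near: E'.
have small : K * `|Z| * `|E' - E| <= e.
  apply: le_trans (_ : (K * `|Z| + 1) * `|E' - E| <= _).
    by rewrite ler_wpM2r// lerDl.
  rewrite -ler_pdivlMl// mulrC distrC.
  by near: E'; apply: (@cvgr_dist_le _ _ _ (nbhs E) _ id E) => //; exact: divr_gt0.
pose D x := a * (J E' x - J E' 0) - a * (J E x - J E 0) - (E' - E) * x
     - a * v E x * (y E' x - y E x).
pose dD x := 2^-1 * a * (v E' x - v E x) ^+ 2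
     - (V (y E' x) - V (y E x) - dV (y E x) * (y E' x - y E x)).
have DE (x : R) : -1 < x -> is_derive x 1 D (dD x).
  move=> x1; have := dJ x x1; have := dJ' x x1 => j1 j2.
  apply: is_derive_eq; rewrite /GRing.scale/= /dD.
  have h1 := en x; have h2 := en' x.
  have -> : V (y E' x) = E' - 2^-1 * a * v E' x ^+ 2 by rewrite h2; ring.
  have -> : V (y E x) = E - 2^-1 * a * v E x ^+ 2 by rewrite h1; ring.
  by field.
have dDle x : 0 <= x <= Z -> `|dD x| <= K * `|E' - E| ^+ 2.
  move=> xZ; rewrite /dD; apply: le_trans (ler_normB _ _) _.
  rewrite /K mulrDl addrC; apply: lerD.
    have yx : `|y E' x - y E x| <= C * `|E' - E| by exact: yk.
    apply: le_trans (_ : L * `|y E' x - y E x| * `|y E' x - y E x| <= _).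
      apply: taylor1_le => // u hu.
      apply: le_trans (derive_bounded_lipschitz ddVE ddVL _ _) _.
      by rewrite ler_wpM2l.
    rewrite -mulrA -mulrA ler_wpM2l// -[leLHS]expr2 -exprMn.
    by rewrite lerXn2r// nnegrE mulr_ge0// ltW.
  rewrite 2!normrM normrX (ger0_norm (_ : 0 <= 2^-1)) ?invr_ge0//.
  rewrite (mulrC 2^-1) -[leRHS]mulrA -exprMn ler_wpM2l ?divr_ge0//.
  by rewrite lerXn2r ?vk// nnegrE mulr_ge0// ltW.
have /andP[z0 zleZ] := zZ.
have [||x] := @MVT_segment R D dD 0 z z0.
- by move=> x; rewrite in_itv/= => /andP[x0 _]; apply: DE; lra.
- by apply: is_derive_cts_in => x /andP[x0 _]; apply: DE; lra.
rewrite in_itv/= => /andP[x0 xz].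
have -> : D 0 = 0 by rewrite /D y0; ring.
rewrite !subr0 => hx; rewrite -/(D z) hx normrM (ger0_norm z0).
apply: le_trans (_ : K * `|E' - E| ^+ 2 * `|Z| <= _).
  apply: ler_pM => //; first by apply: dDle; lra.
  by rewrite (le_trans zleZ)// ler_norm.
have -> : K * `|E' - E| ^+ 2 * `|Z| = K * `|Z| * `|E' - E| * `|E' - E| by ring.
by rewrite ler_wpM2r.
Unshelve. all: by end_near. Qed.

(** Evaluate [action_expansion] at z = tau E'. There y E' takes the value y E
    (tau E), so the action at E' is, up to small terms, (E' - E) * tau E' plus
    a function P of tau E' whose derivative at tau E vanishes. *)
Lemma action_derive (tau : R -> R) (C : R) :
  0 < tau E -> 0 < C ->
  (\forall E' \near E, `|tau E' - tau E| <= C * `|E' - E|) ->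
  (\forall E' \near E, y E' (tau E') = y E (tau E)) ->
  is_derive E 1 (fun E' => a * (J E' (tau E') - J E' 0)) (tau E).
Proof.
move=> t0 C0 tC tE; apply/is_derive_littleoP => e e0.
have [dy dv en _ dJ] := nbhs_singleton waveE.
have tc : {for E, continuous tau}.
  apply/cvgrPdist_le => r r0; near=> E'.
  rewrite distrC; apply: le_trans (_ : C * `|E' - E| <= _); first by near: E'.
  rewrite -ler_pdivlMl// mulrC distrC; near: E'.
  by apply: (@cvgr_dist_le _ _ _ (nbhs E) _ id E) => //; exact: divr_gt0.
set T := tau E in t0 tE tC *.
pose P z := a * (J E z - J E 0) - a * v E z * (y E z - y E T).
have dP : is_derive T 1 P 0.
  have j1 : is_derive T 1 (J E) (v E T ^+ 2) by apply: dJ; lra.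
  by apply: is_derive_eq; rewrite /GRing.scale/=; field.
have e3 : 0 < e / 3 by rewrite divr_gt0.
have e3C : 0 < e / 3 / C by rewrite !divr_gt0.
have Plo : \forall E' \near E, `|P (tau E') - P T| <= e / 3 / C * `|tau E' - T|.
  have := iffLR (is_derive_littleoP _ _ _) dP _ e3C.
  move=> h; near=> E'.
  have : `|P (tau E') - P T - (tau E' - T) * 0| <= e / 3 / C * `|tau E' - T|.
    by near: E'; exact: (tc _ h).
  by rewrite mulr0 subr0.
have Aex := @action_expansion (T + 1) _ e3.
near=> E'.
have yE' : y E' (tau E') = y E T by near: E'.
have h1 : `|P (tau E') - P T| <= e / 3 / C * `|tau E' - T| by near: E'.
have h2 : `|tau E' - T| <= C * `|E' - E| by near: E'.
have h3 : `|tau E' - T| <= e / 3.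
  by rewrite distrC; near: E'; move/cvgrPdist_le: tc; exact.
have tZ : 0 <= tau E' <= T + 1.
  by apply/andP; split; near: E';
    [apply: (cvgr_ge _ tc)|apply: (cvgr_le _ tc); rewrite ltrDl].
have h4 : forall z, 0 <= z <= T + 1 ->
  `|a * (J E' z - J E' 0) - a * (J E z - J E 0) - (E' - E) * z
     - a * v E z * (y E' z - y E z)| <= e / 3 * `|E' - E| by near: E'.
have {}h4 := h4 _ tZ.
set A := (X in `|X| <= _) in h4.
have -> : a * (J E' (tau E') - J E' 0) - a * (J E T - J E 0) - (E' - E) * T =
  A + (P (tau E') - P T) + (E' - E) * (tau E' - T).
  by rewrite /A /P yE' subrr mulr0; ring.
apply: le_trans (ler_normD _ _) _; rewrite normrM.
have h5 := ler_normD A (P (tau E') - P T).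
have h6 : `|P (tau E') - P T| <= e / 3 * `|E' - E|.
  apply: le_trans h1 _.
  have -> : e / 3 * `|E' - E| = e / 3 / C * (C * `|E' - E|).
    by rewrite mulrA divfK// gt_eqF.
  by rewrite ler_wpM2l// ltW.
have h7 : `|E' - E| * `|tau E' - T| <= e / 3 * `|E' - E|.
  by rewrite mulrC ler_wpM2r.
have -> : e * `|E' - E| = e / 3 * `|E' - E| + e / 3 * `|E' - E| + e / 3 * `|E' - E|.
  by field.
by rewrite lerD// (le_trans h5)// lerD.
Unshelve. all: by end_near. Qed.
End Action.

(** * Two-by-two matrices with equal diagonal entries *)

Lemma ord2_cases (j : 'I_2) : j = 0 \/ j = 1.
Proof. by case: j => [[|[|//]] ?]; [left|right]; apply/val_inj. Qed.

Lemma sum_ord2 (K : nzRingType) (g : 'I_2 -> K) : \sum_(i < 2) g i = g 0 + g 1.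
Proof.
rewrite !big_ord_recl big_ord0 addr0.
by congr (g _ + g _); apply/val_inj.
Qed.

Lemma mul_mx22 (K : nzRingType) (a b c d a' b' c' d' : K) :
  mx22 a b c d *m mx22 a' b' c' d' =
  mx22 (a * a' + b * c') (a * b' + b * d') (c * a' + d * c') (c * b' + d * d').
Proof.
apply/matrixP => i j; rewrite !mxE sum_ord2 !mxE.
by have [->|->] := ord2_cases i; have [->|->] := ord2_cases j.
Qed.

Lemma eigenvalue_mx22 (K : fieldType) (d b c l : K) : b != 0 ->
  eigenvalue (mx22 d b c d) l = ((l - d) ^+ 2 == b * c).
Proof.
move=> b0; apply/eigenvalueP/eqP => [[w wA w0]|lE].
  have := congr1 (fun m : 'rV_2 => m 0 0) wA.
  have := congr1 (fun m : 'rV_2 => m 0 1) wA.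
  rewrite !mxE !sum_ord2 !mxE /=.
  set x := w 0 0; set y := w 0 1 => h1 h2.
  have h1' : (l - d) * y = x * b by rewrite mulrBl -h1; ring.
  have h2' : (l - d) * x = y * c by rewrite mulrBl -h2; ring.
  have y0 : y != 0.
    apply: contra w0 => /eqP y0; apply/eqP/rowP => j.
    have x0 : x = 0.
      apply/eqP; move/eqP: h1'.
      by rewrite y0 mulr0 eq_sym mulf_eq0 (negPf b0) orbF.
    by rewrite mxE; have [->|->] := ord2_cases j.
  by apply: (mulIf y0); rewrite expr2 -mulrA h1' mulrA h2'; ring.
(* an eigenvector even when l = d, because b != 0 *)
exists (\row_j if j == 0 then l - d else b).
  apply/rowP => j; rewrite !mxE sum_ord2 !mxE /=.
  have [->|->] := ord2_cases j; rewrite /=; last by ring.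
  by rewrite -lE; ring.
apply/negP => /eqP/rowP/(_ 1); rewrite !mxE /= => bE.
by rewrite bE eqxx in b0.
Qed.

Lemma complex_eigenvalue_mx22 (R : realType) (d b c : R) (l : R[i]) : b != 0 ->
  complex_eigenvalue (mx22 d b c d) l <->
  (complex.Re l - d) ^+ 2 - complex.Im l ^+ 2 = b * c /\
  (complex.Re l - d) * complex.Im l = 0.
Proof.
move=> b0; rewrite /complex_eigenvalue.
have -> : map_mx (real_complex R) (mx22 d b c d) =
    mx22 d%:C%C b%:C%C c%:C%C d%:C%C.
  apply/matrixP => i j; rewrite !mxE.
  by have [->|->] := ord2_cases i; have [->|->] := ord2_cases j.
rewrite eigenvalue_mx22 ?(fmorph_eq0 (real_complex R))//.
case: l => x y; rewrite eq_complex /= expr2 /=; split.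
  move=> /andP[/eqP h1 /eqP h2].
  by split; lra.
by move=> [h1 h2]; apply/andP; split; apply/eqP; lra.
Qed.

Lemma diagonalizable_mx22 (R : realType) (d b c : R) : b != 0 ->
  0 < b * c -> diagonalizable (mx22 d b c d).
Proof.
move=> b0 bc0; pose r := Num.sqrt (b * c).
have r0 : 0 < r by rewrite sqrtr_gt0.
have r2 : r * r = b * c by rewrite -expr2 sqr_sqrtr// ltW.
have rn0 : r != 0 by rewrite gt_eqF.
(* the rows of P are eigenvectors for d + r and d - r *)
pose P := mx22 r b (- r) b.
have [Pu _] : P \in unitmx /\
    mx22 (2 * r)^-1 (- (2 * r)^-1) (2 * b)^-1 (2 * b)^-1 \in unitmx.
  apply: mulmx1_unit; rewrite mul_mx22; apply/matrixP => i j; rewrite !mxE.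
  by have [->|->] := ord2_cases i; have [->|->] := ord2_cases j; rewrite /=; field;
    rewrite ?b0 ?rn0.
exists P => //; apply/diagonalizable_forPex.
exists (\row_j if j == 0 then d + r else d - r).
apply/(simmxP Pu).
have -> : diag_mx (\row_j (if j == 0 then d + r else d - r)) =
    mx22 (d + r) 0 0 (d - r).
  apply/matrixP => i j; rewrite !mxE.
  by have [->|->] := ord2_cases i; have [->|->] := ord2_cases j.
rewrite !mul_mx22; apply/matrixP => i j; rewrite !mxE.
have [->|->] := ord2_cases i; have [->|->] := ord2_cases j; rewrite /=; try ring.
- by rewrite -r2; ring.
- by rewrite -r2; ring.
Qed.

(** When b * c = 0 the only eigenvalue is d, and a diagonalizable matrix would
    then be scalar, against b != 0. *)
Lemma hyperbolic_mx22 (R : realType) (d b c : R) : b != 0 ->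
  ((forall l, complex_eigenvalue (mx22 d b c d) l -> complex.Im l = 0) /\
   diagonalizable (mx22 d b c d)) <-> 0 < b * c.
Proof.
move=> b0; split=> [[real diag]|bc0]; last first.
  split; last exact: diagonalizable_mx22.
  move=> l /complex_eigenvalue_mx22 -/(_ b0)[h1 h2].
  apply/eqP; apply/negP => /negP iml.
  move/eqP: h2; rewrite mulf_eq0 (negPf iml) orbF => /eqP h2.
  by move: bc0; rewrite -h1 h2 expr0n/= sub0r oppr_gt0 ltNge sqr_ge0.
have [//|bc0|bc0] := ltrgtP 0 (b * c).
  pose r := Num.sqrt (- (b * c)).
  have r2 : r ^+ 2 = - (b * c) by rewrite sqr_sqrtr// oppr_ge0 ltW.
  have := real (Complex d r); rewrite complex_eigenvalue_mx22//= => h.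
  have r0 : r = 0 by apply: h; rewrite subrr r2; split; ring.
  by move: r2; rewrite r0 expr0n/= => /esym/eqP; rewrite oppr_eq0 lt_eqF.
have c0 : c = 0.
  by move/esym/eqP: bc0; rewrite mulf_eq0 (negPf b0) => /eqP.
case: diag => P Pu /diagonalizable_forPex[D /(simmxP Pu) PA].
exfalso.
have De i : D 0 i = d.
  apply/eqP; rewrite -subr_eq0 -sqrf_eq0 -[X in _ == X](mulr0 b) -c0.
  rewrite -eigenvalue_mx22//; apply/eigenvalueP; exists (row i P).
    by rewrite -row_mul PA row_mul row_diag_mx -scalemxAl -rowE.
  apply: contraTneq Pu => Pi0; rewrite -row_free_unit -kermx_eq0.
  apply/negP => /eqP k0.
  have : ((delta_mx 0 i : 'rV_2) <= kermx P)%MS.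
    by apply/sub_kermxP; rewrite -rowE.
  by rewrite k0 submx0 => /eqP/rowP/(_ i); rewrite !mxE !eqxx => /eqP;
    rewrite oner_eq0.
have : mx22 d b c d = d%:M.
  rewrite -[LHS](mulKmx Pu) PA.
  have -> : D = const_mx d by apply/rowP => i; rewrite De mxE.
  by rewrite diag_const_mx mul_scalar_mx -scalemxAr mulVmx// scalemx1.
move=> /matrixP/(_ 0 1); rewrite !mxE /= => /eqP.
by rewrite (negPf b0).
Qed.

Lemma elliptic_mx22 (R : realType) (d b c : R) : b != 0 ->
  (exists l, [/\ complex.Im l != 0, complex_eigenvalue (mx22 d b c d) l &
                complex_eigenvalue (mx22 d b c d) (conjc l)]) <-> b * c < 0.
Proof.
move=> b0; split=> [[l [iml]]|bc0].
  move=> /complex_eigenvalue_mx22 -/(_ b0)[h1 h2] _.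
  move/eqP: h2; rewrite mulf_eq0 (negPf iml) orbF => /eqP h2.
  by rewrite -h1 h2 expr0n/= sub0r oppr_lt0 lt_def sqrf_eq0 iml sqr_ge0.
pose r := Num.sqrt (- (b * c)).
have r2 : r ^+ 2 = - (b * c) by rewrite sqr_sqrtr// oppr_ge0 ltW.
exists (Complex d r); split.
- by rewrite gt_eqF// sqrtr_gt0 oppr_gt0.
- apply/complex_eigenvalue_mx22 => //=.
  by rewrite subrr r2; split; ring.
- apply/complex_eigenvalue_mx22 => //=.
  by rewrite subrr sqrrN r2; split; ring.
Qed.

(** * Traveling waves of a fixed speed *)

Section Waves.
Context (R : realType) (V : R -> R) (umin umax : R).
Hypothesis hV : potential V umin umax.
Context (f : R -> R -> R -> R) (T : R -> R -> R).
Hypothesis hf : normalized_waves V umin umax f T.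
Context (c : R).

Local Notation a := (c ^+ 2 - 1).
Local Notation dV := (derive1 V).
Local Notation ddV := (derive1n 2 V).
Local Notation u0 := (if c ^+ 2 < 1 then umax else umin).
Local Notation y E := (f E c).
Local Notation v E := (derive1 (f E c)).

Lemma potential_derive (x : R) : is_derive x 1 V (dV x).
Proof. by have [[h _ _] _ _ _ _] := hV; rewrite derive1E; apply/derivableP. Qed.

Lemma potential_derive2 (x : R) : is_derive x 1 dV (ddV x).
Proof.
have [[_ h _] _ _ _ _] := hV.
by rewrite derive1nS/= derive1E; apply/derivableP/h.
Qed.

Lemma potential_periodic : periodic V (2 * pi).
Proof. by have [_ []] := hV. Qed.

Lemma potential_derive_periodic : periodic dV (2 * pi).
Proof.
by apply: periodic_derive1 potential_periodic => x; have [] := potential_derive x.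
Qed.

Lemma potential_derive2_bounded : exists L, forall x, `|ddV x| <= L.
Proof.
have [[_ h hc] _ _ _ _] := hV.
have p0 : 0 < 2 * pi :> R by rewrite mulr_gt0// pi_gt0.
have gp : periodic ddV (2 * pi).
  by rewrite derive1nS/=; exact: (periodic_derive1 h potential_derive_periodic).
exact: (periodic_bounded p0 gp hc).
Qed.

(** The domain is open in the energy, and librations and rotations do not mix
    locally. *)
Lemma wave_domain_near E : wave_domain E c ->
  \forall E' \near E, wave_domain E' c /\ (`|E'| < 1) = (`|E| < 1).
Proof.
have lt1 : `|E| < 1 -> \forall E' \near E, `|E'| < 1.
  by move=> h; apply: (@cvgr_norm_lt _ _ _ (nbhs E) _ id E) => //.
case=> [[c1 h]|[c1 h]|[c1 h]|[c1 h]].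
- near=> E'; have h' : `|E'| < 1 by near: E'; exact: lt1.
  by rewrite h h'; split=> //; apply: Or41.
- near=> E'; have h' : E' < -1 by near: E'; exact: lt_nbhsl.
  rewrite !ltr_norml [_ < E']ltNge (ltW h') [_ < E]ltNge (ltW h); split=> //.
  exact: Or42.
- near=> E'; have h' : `|E'| < 1 by near: E'; exact: lt1.
  by rewrite h h'; split=> //; apply: Or43.
- near=> E'; have h' : 1 < E' by near: E'; exact: lt_nbhsr.
  rewrite !ltr_norml [E' < _]ltNge (ltW h') [E < _]ltNge (ltW h) !andbF; split=> //.
  exact: Or44.
Unshelve. all: by end_near. Qed.

Lemma wave_domain_coef E : wave_domain E c -> a != 0.
Proof. by rewrite subr_eq0; case=> -[c1 _]; rewrite ?(lt_eqF c1) ?(gt_eqF c1). Qed.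

Lemma wave_derive E : wave_domain E c -> forall z : R, is_derive z 1 (y E) (v E z).
Proof.
move=> /hf[[h _ _ _] _ _] z; have [d _ _ _] := h z.
by rewrite derive1E; apply/derivableP.
Qed.

Lemma wave_derive2 E : wave_domain E c ->
  forall z : R, is_derive z 1 (v E) (- dV (y E z) / a).
Proof.
move=> dE; have [[h _ _ _] _ _] := hf dE => z; have [_ d eq _] := h z.
have -> : - dV (y E z) / a = derive1n 2 (y E) z.
  apply: (mulIf (wave_domain_coef dE)); rewrite divfK ?(wave_domain_coef dE)//.
  by apply/eqP; rewrite eq_sym -addr_eq0 mulrC; apply/eqP.
by rewrite derive1nS/= derive1E; apply/derivableP.
Qed.

Lemma wave_energy E : wave_domain E c ->
  forall z, 2^-1 * a * v E z ^+ 2 = E - V (y E z).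
Proof. by move=> /hf[[h _ _ _] _ _] z; have [] := h z. Qed.

Lemma wave_init E : wave_domain E c -> y E 0 = u0 /\ 0 < v E 0.
Proof. by move=> /hf[]. Qed.

(** Rotations advance by + 2 pi rather than - 2 pi because their velocity is
    positive at 0 and never vanishes. *)
Definition shift_size (E : R) : R := if `|E| < 1 then 0 else 2 * pi.

Lemma shift_size_ge0 E : 0 <= shift_size E.
Proof. by rewrite /shift_size; case: ifP => // _; rewrite mulr_ge0// pi_ge0. Qed.

Lemma shift_size_inv (g : R -> R) E u : periodic g (2 * pi) ->
  g (u + shift_size E) = g u.
Proof. by move=> gp; rewrite /shift_size; case: ifP => _; rewrite ?addr0. Qed.

Lemma wave_newton E : wave_domain E c ->
  newton (fun u => - dV u / a) (y E) (v E).
Proof. by move=> dE; split; [exact: wave_derive|exact: wave_derive2]. Qed.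

Lemma force_derive (x : R) : is_derive x 1 (fun u => - dV u / a) (- ddV x / a).
Proof.
have := potential_derive2 x => h.
by apply: is_derive_eq; rewrite /GRing.scale/=; ring.
Qed.

Lemma force_bounded : exists L, forall x, `|- ddV x / a| <= L.
Proof.
have [L hL] := potential_derive2_bounded; exists (L * `|a^-1|) => x.
by rewrite normrM normrN ler_wpM2r.
Qed.

(** Outside [-1, 1] the energy never equals the potential, so the velocity has
    no zero and keeps its initial sign. *)
Lemma rotational_velocity_gt0 E : wave_domain E c -> ~~ (`|E| < 1) ->
  forall z, 0 <= z -> 0 < v E z.
Proof.
move=> dE nE z z0; have [_ v0] := wave_init dE.
have vn0 x : v E x != 0.
  apply/eqP => vx; have := wave_energy dE x; rewrite vx expr0n mulr0.
  have [_ _ _ _ [_ _ /(_ (y E x))/andP[h1 h2]]] := hV.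
  case: dE nE => -[_ h]; rewrite ?h//= => _; lra.
rewrite ltNge; apply/negP => vz.
have [||x _ vx] := @IVT R (v E) 0 z 0 z0.
- by apply: is_derive_cts_in => x _; exact: wave_derive2.
- by rewrite ge_min vz orbT le_max (ltW v0).
by have := vn0 x; rewrite vx eqxx.
Qed.

(** Minimality among shifts becomes minimality among return times because, by
    uniqueness for Newton's equation, returning to the initial state at one
    time already makes the whole profile invariant under the corresponding
    shift. *)
Lemma wave_period_return E : wave_domain E c ->
  [/\ 0 < T E c, returns (y E) (v E) (shift_size E) (T E c) &
      forall z, 0 < z -> returns (y E) (v E) (shift_size E) z -> T E c <= z].
Proof.
move=> dE; have [[_ _ vper [T0 sh mint]] _ _] := hf dE.
split=> //.
  split; last by rewrite -(vper 0) add0r.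
  move: sh; rewrite /wave_shift /shift_size; case: ifPn => [_ /(_ 0)|nE].
    by rewrite add0r addr0.
  case=> /(_ 0); rewrite add0r// => yT; exfalso.
  have [|x] := @MVT R (y E) (v E) _ _ T0 (fun z _ => wave_derive dE z).
    by apply: is_derive_cts_in => z _; exact: wave_derive.
  rewrite in_itv/= => /andP[x0 _]; rewrite yT subr0 => h.
  have := mulr_gt0 (rotational_velocity_gt0 dE nE (ltW x0)) T0.
  rewrite -h; have := pi_gt0 R; lra.
move=> z z0 [yz vz]; apply: mint => //.
have [L hL] := force_bounded.
have L0 : 0 <= L by exact: le_trans (hL 0).
have key x : y E (x + z) = y E x + shift_size E.
  have [dy dv] := wave_newton dE.
  apply: (@newton_unique _ _ L (fun x => y E (x + z)) (fun x => v E (x + z))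
     (fun x => y E x + shift_size E) (v E)
     (derive_bounded_lipschitz force_derive hL) L0).
  - split=> t.
      by apply: is_derive_eq; rewrite /GRing.scale/=; ring.
    by apply: is_derive_eq; rewrite /GRing.scale/=; ring.
  - split=> t.
      by apply: is_derive_eq; rewrite addr0.
    by rewrite (shift_size_inv _ _ potential_derive_periodic); exact: dv.
  - by rewrite add0r.
  - by rewrite add0r.
rewrite /wave_shift; move: key; rewrite /shift_size; case: ifP => _ key.
  by move=> x; rewrite key addr0.
by left.
Qed.

(** At z = 0 the energy identity reads a / 2 * v(0) ^ 2 = E - V(y(0)), where
    the height y(0) does not depend on E. *)
Lemma wave_velocity_derive E : wave_domain E c ->
  is_derive E 1 (fun E' => v E' 0) (a * v E 0)^-1.
Proof.
move=> dE; have a0 := wave_domain_coef dE; have [y0 v0] := wave_init dE.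
have vE E' : wave_domain E' c -> v E' 0 = Num.sqrt (2 * a^-1 * (E' - V u0)).
  move=> dE'; have [y0' v0'] := wave_init dE'.
  rewrite -y0' -(wave_energy dE').
  have -> : 2 * a^-1 * (2^-1 * a * v E' 0 ^+ 2) = v E' 0 ^+ 2 by field.
  by rewrite sqrtr_sqr gtr0_norm.
apply: (@near_eq_is_derive _ _ _ (fun E' => Num.sqrt (2 * a^-1 * (E' - V u0)))).
  have := wave_domain_near dE; apply: filterS => E' [dE' _].
  by rewrite vE.
have p0 : 0 < 2 * a^-1 * (E - V u0).
  by rewrite -sqrtr_gt0 -vE.
have sd := is_derive1_sqrt p0.
apply: is_derive_eq; rewrite /GRing.scale/= -vE//.
by field; rewrite a0 gt_eqF.
Qed.
End Waves.

(** * Derivatives in the energy of the period and of the action *)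

Section Periods.
Context (R : realType) (V : R -> R) (umin umax : R).
Hypothesis hV : potential V umin umax.
Context (f : R -> R -> R -> R) (T : R -> R -> R).
Hypothesis hf : normalized_waves V umin umax f T.
Context (c E : R).
Hypothesis dE : wave_domain E c.

Local Notation a := (c ^+ 2 - 1).
Local Notation dV := (derive1 V).
Local Notation ddV := (derive1n 2 V).
Local Notation y E := (f E c).
Local Notation v E := (derive1 (f E c)).

Let a0 : a != 0 := wave_domain_coef dE.

Lemma wave_family : \forall E' \near E,
  newton (fun u => - dV u / a) (y E') (v E') /\ y E' 0 = y E 0.
Proof.
have := wave_domain_near dE; apply: filterS => E' [dE' _].
split; first exact: (wave_newton hf dE').
by rewrite (wave_init hf dE').1 (wave_init hf dE).1.
Qed.

Lemma wave_lipschitz Z :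
  uniform_lipschitz (fun E => y E) E Z /\ uniform_lipschitz (fun E => v E) E Z.
Proof.
have [L hL] := force_bounded hV c.
exact: (@family_lipschitz _ _ _ L (force_derive hV c) hL (fun E => y E)
  (fun E => v E) E _ wave_family (wave_velocity_derive hf dE) Z).
Qed.

Lemma wave_period_near : \forall E' \near E,
  [/\ 0 < T E' c, returns (y E') (v E') (shift_size E) (T E' c) &
      forall z, 0 < z -> returns (y E') (v E') (shift_size E) z -> T E' c <= z].
Proof.
have := wave_domain_near dE; apply: filterS => E' [dE' eE].
have := wave_period_return hV hf dE'.
by have -> : shift_size E' = shift_size E by rewrite /shift_size eE.
Qed.

Lemma wave_return_near : \forall E' \near E, y E' (T E' c) = y E (T E c).
Proof.
have [_ [yE _] _] := wave_period_return hV hf dE.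
near=> E'.
have [_ [yE' _] _] : [/\ 0 < T E' c,
      returns (y E') (v E') (shift_size E) (T E' c) &
      forall z, 0 < z -> returns (y E') (v E') (shift_size E) z -> T E' c <= z].
  by near: E'; exact: wave_period_near.
have [_ y0] : newton (fun u => - dV u / a) (y E') (v E') /\ y E' 0 = y E 0.
  by near: E'; exact: wave_family.
by rewrite yE' yE y0.
Unshelve. all: by end_near. Qed.

Lemma period_continuous : {for E, continuous (T ^~ c)}.
Proof.
apply: (@first_return_continuous _ (fun E => y E) (fun E => v E) (T ^~ c) E
  (shift_size E)).
- by move=> Z; case: (wave_lipschitz Z).
- by move=> Z; case: (wave_lipschitz Z).
- exact: shift_size_ge0.
- have := wave_domain_near dE; apply: filterS => E' [dE' _].
  have [y0' v0'] := wave_init hf dE'; have [y0 _] := wave_init hf dE.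
  split=> //.
  + exact: (wave_derive hf dE').
  + by move=> z; exact: is_derive_cts (wave_derive2 hf dE' z).
  + by rewrite y0' y0.
  + move=> z yz; apply: (mulfI (_ : 2^-1 * a != 0)).
      by rewrite mulf_neq0// invr_eq0.
    rewrite !(wave_energy hf dE') yz.
    by rewrite (shift_size_inv _ _ (potential_periodic hV)).
- exact: wave_period_near.
Qed.

Lemma wave_slope : is_derive (T E c) 1 (y E) (v E 0).
Proof.
have [_ [_ <-] _] := wave_period_return hV hf dE.
exact: (wave_derive hf dE).
Qed.

Lemma period_in : 0 < T E c < T E c + 1.
Proof. by have [T0 _ _] := wave_period_return hV hf dE; rewrite T0 ltrDl ltr01. Qed.

Lemma velocity_neq0 : v E 0 != 0.
Proof. by have [_ v0] := wave_init hf dE; rewrite gt_eqF. Qed.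

Lemma period_lipschitz : exists2 C, 0 < C &
  \forall E' \near E, `|T E' c - T E c| <= C * `|E' - E|.
Proof.
exact: (@implicit_lipschitz _ (fun E => y E) (T ^~ c) E (T E c + 1) (v E 0)
  (wave_lipschitz _).1 period_in period_continuous wave_return_near
  wave_slope velocity_neq0).
Qed.

Lemma velocity_sqr_primitive : exists J : R -> R -> R, forall E',
  wave_domain E' c ->
  (forall z : R, -1 < z -> is_derive z 1 (J E') (v E' z ^+ 2)) /\
  (forall b, 0 < b ->
    \int[lebesgue_measure]_(z in `[0, b]) (v E' z ^+ 2) = J E' b - J E' 0).
Proof.
suff /choice[J hJ] : forall E', exists J : R -> R, wave_domain E' c ->
    (forall z : R, -1 < z -> is_derive z 1 J (v E' z ^+ 2)) /\
    (forall b, 0 < b ->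
      \int[lebesgue_measure]_(z in `[0, b]) (v E' z ^+ 2) = J b - J 0).
  by exists J.
move=> E'.
have [dE'|nE'] := pselect (wave_domain E' c); last by exists id.
have [|J hJ] := @continuous_primitive R (fun z => v E' z ^+ 2).
  move=> z; have := wave_derive2 hf dE' z => h.
  by apply: (@is_derive_cts _ _ _ _); apply: is_derive_eq.
by exists J.
Qed.

Lemma whithamW_derive : is_derive E 1 (whithamW f T ^~ c) (T E c).
Proof.
have [J hJ] := velocity_sqr_primitive.
have [L hL] := potential_derive2_bounded hV.
have [C C0 TC] := period_lipschitz.
apply: (@near_eq_is_derive _ _ _
    (fun E' => a * (J E' (T E' c) - J E' 0))).
  have := wave_domain_near dE; apply: filterS => E' [dE' _].
  have [T0 _ _] := wave_period_return hV hf dE'.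
  by rewrite /whithamW (hJ _ dE').2.
apply: (@action_derive _ V dV ddV L a (potential_derive hV)
  (potential_derive2 hV) hL (fun E => y E) (fun E => v E) J E a0 _ _ _ (T ^~ c) C).
- have := wave_domain_near dE; apply: filterS => E' [dE' _].
  split.
  + exact: (wave_derive hf dE').
  + exact: (wave_derive2 hf dE').
  + exact: (wave_energy hf dE').
  + by rewrite (wave_init hf dE').1 (wave_init hf dE).1.
  + exact: (hJ _ dE').1.
- by move=> Z; case: (wave_lipschitz Z).
- by move=> Z; case: (wave_lipschitz Z).
- by have /andP[] := period_in.
- exact: C0.
- exact: TC.
- exact: wave_return_near.
Qed.

(** W has the sign of a, as the velocity does not vanish at 0. *)
Lemma whithamW_pos : 0 < a * whithamW f T E c.
Proof.
have [J hJ] := velocity_sqr_primitive; have [dJ intJ] := hJ _ dE.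
have [T0 _ _] := wave_period_return hV hf dE.
rewrite /whithamW intJ// mulrA -expr2 mulr_gt0//.
  by rewrite lt_def sqr_ge0 sqrf_eq0 a0.
have Jd (x : R) : 0 <= x -> is_derive x 1 (J E) (v E x ^+ 2).
  by move=> x0; apply: dJ; lra.
have [_ v0] := wave_init hf dE.
have [d d0 [dT vd]] : exists2 d, 0 < d & d < T E c /\
    forall x, `|0 - x| < d -> 0 < v E x.
  have vc := is_derive_cts (wave_derive2 hf dE 0).
  have /nbhs_ballP[b /= b0 hb] : \forall x \near (0 : R), 0 < v E x.
    exact: (cvgr_gt _ vc).
  near (0 : R)^'+ => d; exists d => //; split.
    by near: d; exact: nbhs_right_lt.
  move=> x xd; apply: hb; apply: lt_le_trans xd _.
  by near: d; exact: nbhs_right_le.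
have [||x] := @MVT R (J E) (fun x => v E x ^+ 2) 0 d d0.
- by move=> x; rewrite in_itv/= => /andP[x0 _]; apply: Jd; exact: ltW.
- by apply: is_derive_cts_in => x /andP[x0 _]; exact: Jd.
rewrite in_itv/= subr0 => /andP[x0 xd] J1.
have [||z _ J2] := @MVT R (J E) (fun x => v E x ^+ 2) d (T E c) dT.
- by move=> z; rewrite in_itv/= => /andP[z0 _]; apply: Jd; lra.
- by apply: is_derive_cts_in => z /andP[z0 _]; apply: Jd; lra.
have p1 : 0 < v E x ^+ 2 * d.
  by rewrite mulr_gt0// exprn_gt0// vd// ltr_norml; lra.
have p2 : 0 <= v E z ^+ 2 * (T E c - d).
  by rewrite mulr_ge0 ?sqr_ge0// subr_ge0 ltW.
by rewrite -J1 -J2 in p1 p2; lra.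
Unshelve. all: by end_near. Qed.

(** The second column of the fundamental matrix at lambda = 0 consists of the
    solution of the linearized equation with initial data (0, 1) and of its
    derivative. Scaled by the energy derivative of the initial velocity, it is
    the energy derivative of the profile. *)
Lemma period_derive (F : R -> R -> 'M[R]_2) :
  fundamental_matrix V c (f E c) F ->
  is_derive E 1 (T ^~ c) (- F (T E c) 0 0 1 / (a * v E 0 ^+ 2)).
Proof.
move=> hF; have [F0 dF] := hF 0.
pose k := (a * v E 0)^-1.
have dw (z : R) : is_derive z 1 (fun x => k * F x 0 0 1) (k * F z 0 1 1).
  have h := dF z 0 1; apply: is_derive_eq; rewrite /GRing.scale/=.
  by rewrite mxE sum_ord2 !mxE/=; ring.
have dw1 (z : R) : is_derive z 1 (fun x => k * F x 0 1 1)
    (- ddV (y E z) / a * (k * F z 0 0 1)).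
  have h := dF z 1 1; apply: is_derive_eq; rewrite /GRing.scale/=.
  by rewrite mxE sum_ord2 !mxE/=; field.
have [L hL] := force_bounded hV c.
have ddVc : continuous (fun x => - ddV x / a).
  have [[_ _ hc] _ _ _ _] := hV => x.
  apply: (@continuousM _ _ (fun x => - ddV x) (fun=> a^-1)).
    by apply: continuousN; exact: hc.
  exact: cst_continuous.
have yw : uniform_derive (fun E => y E) (fun z => k * F z 0 0 1) E (T E c + 1).
  apply: (@family_derive _ _ _ L (force_derive hV c) hL (fun E => y E)
    (fun E => v E) E _ wave_family (wave_velocity_derive hf dE)
    (fun z => k * F z 0 0 1) (fun z => k * F z 0 1 1) _ ddVc dw dw1).
  - by rewrite F0 mxE mulr0.
  - by rewrite F0 mxE mulr1.
apply: is_derive_eq.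
  apply: (implicit_derive yw period_in period_continuous wave_return_near
    wave_slope velocity_neq0).
  exact: is_derive_cts (dw _).
by rewrite /k; field; rewrite velocity_neq0 a0.
Qed.
End Periods.

(** * Whitham's matrix *)

Lemma whithamW_E_period (R : realType) (V : R -> R) (umin umax : R)
    (hV : potential V umin umax) (f : R -> R -> R -> R) (T : R -> R -> R)
    (hf : normalized_waves V umin umax f T) (c E : R) :
  wave_domain E c -> whithamW_E f T E c = T E c.
Proof.
by move=> dE; rewrite /whithamW_E derive1E; case: (whithamW_derive hV hf dE).
Qed.

Lemma whithamW_EE_monodromy (R : realType) (V : R -> R) (umin umax : R)
    (hV : potential V umin umax) (f : R -> R -> R -> R) (T : R -> R -> R)
    (hf : normalized_waves V umin umax f T) (c E : R)
    (F : R -> R -> 'M[R]_2) : wave_domain E c ->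
  fundamental_matrix V c (f E c) F ->
  whithamW_EE f T E c =
    - F (T E c) 0 0 1 / ((c ^+ 2 - 1) * derive1 (f E c) 0 ^+ 2).
Proof.
move=> dE hF; rewrite /whithamW_EE derive1E.
have [_ <-] := period_derive hV hf dE hF.
apply: near_eq_derive; have := wave_domain_near dE.
by apply: filterS => E' [dE' _]; rewrite (whithamW_E_period hV hf dE').
Qed.

(** Substituting W_E = T and the formula for W_EE, the off-diagonal product is
    (T / (D p)) ^ 2 * (a * W) * M_12(0), where D is the denominator of
    Whitham's matrix. *)
Lemma whitham_matrix_discriminant (R : realType) (V : R -> R) (umin umax : R)
    (hV : potential V umin umax) (f : R -> R -> R -> R) (T : R -> R -> R)
    (hf : normalized_waves V umin umax f T) (c E : R)
    (F : R -> R -> 'M[R]_2) : wave_domain E c ->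
  fundamental_matrix V c (f E c) F -> whitham_denom f T E c != 0 ->
  exists d b b' k : R, [/\ whitham_matrix f T E c = mx22 d b b' d, b != 0,
    0 < k & b * b' = k * F (T E c) 0 0 1].
Proof.
move=> dE hF den0.
have a0 := wave_domain_coef dE; have [_ v0] := wave_init hf dE.
have [T0 _ _] := wave_period_return hV hf dE.
have aW := whithamW_pos hV hf dE.
have WE := whithamW_E_period hV hf dE.
have WEE := whithamW_EE_monodromy hV hf dE hF.
rewrite /whitham_matrix; set D := whitham_denom f T E c in den0 *.
rewrite WE WEE; set W := whithamW f T E c in aW *.
set m := F _ _ _ _; set p := derive1 _ _ in v0 *; set t := T E c in T0 *.
set Wee := - m / _.
have W0 : W != 0 by apply: contraTneq aW => ->; rewrite mulr0 ltxx.
exists (D^-1 * ((t ^+ 2 + W * Wee) * c)), (D^-1 * (- (W * t))),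
  (D^-1 * ((c ^+ 2 - 1) ^+ 2 * t * Wee)),
  ((t / (D * p)) ^+ 2 * ((c ^+ 2 - 1) * W)).
split.
- apply/matrixP => i j; rewrite !mxE.
  by have [->|->] := ord2_cases i; have [->|->] := ord2_cases j.
- by rewrite mulf_neq0 ?invr_eq0// oppr_eq0 mulf_neq0// gt_eqF.
- rewrite mulr_gt0// exprn_even_gt0//= mulf_neq0 ?invr_eq0 ?mulf_neq0//.
    by rewrite gt_eqF.
  by rewrite gt_eqF.
- by rewrite /Wee; field; rewrite den0 a0 gt_eqF.
Qed.

Theorem theorem9p2 (R : realType) (V : R -> R) (umin umax : R)
    (hV : potential V umin umax)
    (f : R -> R -> R -> R) (T : R -> R -> R)
    (hf : normalized_waves V umin umax f T)
    (E c : R) (hEc : wave_domain E c)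
    (F : R -> R -> 'M[R]_2) (hF : fundamental_matrix V c (f E c) F)
    (hW : c ^+ 2 * whithamW_E f T E c ^+ 2
          + whithamW f T E c * whithamW_EE f T E c != 0) :
  (hyperbolic_at (whitham_matrix f T) E c
     <-> modulational_index F (T E c) = 1) /\
  (elliptic_at (whitham_matrix f T) E c
     <-> modulational_index F (T E c) = -1).
Proof.
have [d [b [b' [k [UE b0 k0 bb']]]]] := whitham_matrix_discriminant hV hf hEc hF hW.
rewrite /hyperbolic_at /elliptic_at /modulational_index /monodromy UE.
have [hyp1 hyp2] := hyperbolic_mx22 d b' b0.
have [ell1 ell2] := elliptic_mx22 d b' b0.
rewrite bb' (pmulr_rgt0 _ k0) in hyp1 hyp2.
rewrite bb' (pmulr_rlt0 _ k0) in ell1 ell2.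
split; split.
- by move=> /hyp1; exact: gtr0_sg.
- by move=> /eqP; rewrite sgr_cp0; exact: hyp2.
- by move=> /ell1; exact: ltr0_sg.
- by move=> /eqP; rewrite sgr_cp0; exact: ell2.
Qed.
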